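(* There exist constants $c_1,c_2>0$ depending only on the dimension $n$ such that for all $f\in L^1(Q_0)$ and all $0<t\le1$, $$c_1\,tF_{f,\sharp}(t)\le K(t,f;L^1,BMO)\le c_2\,tF_{f,\sharp}(t).$$
   Context: $Q_0\subset\mathbb R^n$ is a fixed cube with $|Q_0|=1$; all cubes have sides parallel to the coordinate axes. $P=P(Q_0)$ is the set of all countable (possibly finite) families $\pi=\{Q_i\}$ of subcubes of $Q_0$ with pairwise disjoint interiors. $f_Q=\frac1{|Q|}\int_Qf$. For a measurable $g$ on $Q_0$, $\lambda_g(\tau)=|\{x\in Q_0:|g(x)|>\tau\}|$ and $g^*(t)=\inf\{\tau>0:\lambda_g(\tau)\le t\}$ for $0<t<1$, with $g^*(1):=\lim_{t\to1^-}g^*(t)$. For $\pi=\{Q_i\}\in P$, $$S_{\pi,\sharp}(f)(x)=\sum_{Q_i\in\pi}\Big(\frac1{|Q_i|}\int_{Q_i}|f(y)-f_{Q_i}|\,dy\Big)\chi_{Q_i}(x),\quad x\in Q_0,$$ and $F_{f,\sharp}(t)=\sup_{\pi\in P}(S_{\pi,\sharp}(f))^*(t)$, $0<t\le1$. $\|f\|_{BMO}=\sup_{Q\subset Q_0}\frac1{|Q|}\int_Q|f-f_Q|\,dx$ (supremum over cubes). The Peetre $K$-functional is $K(t,f;A_0,A_1)=\inf\{\|f_0\|_{A_0}+t\|f_1\|_{A_1}: f=f_0+f_1,\ f_i\in A_i\}$. The pair $(L^1,BMO)=(L^1(Q_0),BMO(Q_0))$ is interpreted modulo constants: constant functions are factored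 out, i.e. $L^1$ carries the norm $\inf_{c\in\mathbb R}\|f-c\|_{L^1(Q_0)}$ (equivalently, one restricts to functions with $\int_{Q_0}f=0$). *)

(* Defs.v *)
From HB Require Import structures.
From mathcomp Require Import all_boot all_order all_algebra.
From mathcomp Require Import all_classical all_reals all_analysis.

Set Implicit Arguments.
Unset Strict Implicit.
Unset Printing Implicit Defensive.

Import Order.TTheory GRing.Theory Num.Theory.
Import numFieldNormedType.Exports.

Local Open Scope classical_set_scope.
Local Open Scope ring_scope.

(* The sigma-algebra on tuples is generated by the coordinates: it is the
   Borel sigma-algebra of R^n. *)
Notation Rn R n := (n.-tuple (measurableTypeR R)).

Section lebesgue_measure_Rn.
Local Open Scope ereal_scope.
Context {R : realType}.

Definition consRn n (p : measurableTypeR R * Rn R n) : Rn R n.+1 :=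
  [the n.+1.-tuple (measurableTypeR R) of p.1 :: p.2].

Lemma measurable_consRn n :
  measurable_fun [set: measurableTypeR R * Rn R n] (@consRn n).
Proof. exact: measurable_cons. Qed.

Definition lebesgueS n (m : {sigma_finite_measure set (Rn R n) -> \bar R}) :
    set (Rn R n.+1) -> \bar R :=
  pushforward (@lebesgue_measure R \x m) (@consRn n).

Section lebesgueS_measure.
Context n (m : {sigma_finite_measure set (Rn R n) -> \bar R}).

Let lebesgueS0 : lebesgueS m set0 = 0.
Proof. by rewrite /lebesgueS /pushforward preimage_set0 measure0. Qed.

Let lebesgueS_ge0 A : 0 <= lebesgueS m A.
Proof. by rewrite /lebesgueS /pushforward measure_ge0. Qed.

Let lebesgueS_sigma_additive : semi_sigma_additive (lebesgueS m).
Proof.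
exact: (measure_semi_sigma_additive
  (s := measure_function_pushforward__canonical__measure_function_Measure
     (@lebesgue_measure R \x m) (@measurable_consRn n))).
Qed.

HB.instance Definition _ := isMeasure.Build _ _ _ (lebesgueS m)
  lebesgueS0 lebesgueS_ge0 lebesgueS_sigma_additive.

Let uncons (x : Rn R n.+1) : measurableTypeR R * Rn R n :=
  (thead x, [tuple of behead x]).

Let measurable_uncons : measurable_fun setT uncons.
Proof.
apply/measurable_fun_pair; last exact: measurable_behead.
exact: measurable_tnth.
Qed.

Let consRnK (p : measurableTypeR R * Rn R n) : uncons (consRn p) = p.
Proof.
by case: p => a t; rewrite /uncons; congr pair; exact/val_inj.
Qed.

Lemma lebesgueS_setX (A : set (measurableTypeR R)) (B : set (Rn R n)) :
  measurable A -> measurable B ->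
  lebesgueS m [set x | A (thead x) /\ B [tuple of behead x]] =
  lebesgue_measure A * m B.
Proof.
move=> mA mB; rewrite -product_measure1E// /lebesgueS /pushforward.
congr ((_ \x _) _); apply/funext => p; apply: propext.
have e1 : thead (consRn p) = p.1 := congr1 fst (consRnK p).
have e2 : [tuple of behead (consRn p)] = p.2 := congr1 snd (consRnK p).
by split => -[]; rewrite /= ?e1 ?e2.
Qed.

Let lebesgueS_sigma_finite : sigma_finite setT (lebesgueS m).
Proof.
have /sigma_finiteP[F [TF ndF Foo]] := sigma_finiteT (@lebesgue_measure R).
have /sigma_finiteP[G [TG ndG Goo]] := sigma_finiteT m.
exists (fun k => [set x | F k (thead x) /\ G k [tuple of behead x]]).
  apply/seteqP; split => // x _.
  have [i _ Fi] : (\bigcup_i F i) (thead x) by rewrite -TF.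
  have [j _ Gj] : (\bigcup_i G i) [tuple of behead x] by rewrite -TG.
  exists (maxn i j) => //; split.
    by move: Fi; exact/subsetPset/ndF/leq_maxl.
  by move: Gj; exact/subsetPset/ndG/leq_maxr.
move=> k; have [mF Fk] := Foo k; have [mG Gk] := Goo k; split.
  have := measurable_uncons measurableT (measurableX mF mG).
  by rewrite setTI.
by rewrite lebesgueS_setX// lte_mul_pinfty// ge0_fin_numE.
Qed.

HB.instance Definition _ := Measure_isSigmaFinite.Build _ _ _ (lebesgueS m)
  lebesgueS_sigma_finite.

End lebesgueS_measure.

Fixpoint lebesgueRn n : {sigma_finite_measure set (Rn R n) -> \bar R} :=
  match n with
  | 0%N => \d_([tuple] : Rn R 0)
  | n'.+1 => lebesgueS (lebesgueRn n')
  end.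

End lebesgue_measure_Rn.

Section cubes.
Context {R : realType} {n : nat}.
Implicit Types (a x : Rn R n) (r : R) (Q : set (Rn R n)).

Definition cube a r : set (Rn R n) :=
  [set x | forall i, tnth a i <= tnth x i <= tnth a i + r].

Definition is_cube Q := exists a r, 0 < r /\ Q = cube a r.

Definition subcube Q0 Q := is_cube Q /\ Q `<=` Q0.

(* The library puts no topology on tuples; this is the interior for the
   sup-norm topology of R^n. *)
Definition interiorRn (A : set (Rn R n)) : set (Rn R n) :=
  [set x | exists2 e : R, 0 < e &
    forall y, (forall i, `|tnth x i - tnth y i| < e) -> A y].

Definition packing Q0 : set (set (set (Rn R n))) :=
  [set p | [/\ countable p, p `<=` subcube Q0 &
    forall Q Q', p Q -> p Q' -> Q <> Q' ->
      interiorRn Q `&` interiorRn Q' = set0]].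

End cubes.

Lemma lebesgueRn_cube (R : realType) n (a : Rn R n) (r : R) : 0 < r ->
  measurable (cube a r) /\ lebesgueRn n (cube a r) = (r ^+ n)%:E.
Proof.
move=> r0; elim: n a => [|n IH] a.
  have -> : cube a r = setT by apply/seteqP; split => x // _ [].
  by split; [exact: measurableT|rewrite /= diracT].
have [mB muB] := IH [tuple of behead a].
have -> : cube a r = [set x : Rn R n.+1 |
    `[thead a, thead a + r]%classic (thead x) /\
    cube [tuple of behead a] r [tuple of behead x]].
  apply/seteqP; split => x /=.
    by move=> xa; split=> [|i]; [exact: xa|rewrite !tnth_behead].
  move=> [x0 xS] i; have [->//|i0] := eqVneq i ord0.
  have [j ->] : exists j, i = lift ord0 j.
    by case: (unliftP ord0 i) => [j ->|i0']; [exists j|rewrite i0' eqxx in i0].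
  by have := xS j; rewrite !tnth_behead (_ : inord _ = lift ord0 j)//;
    apply/val_inj; rewrite /= inordK// ltnS.
split.
  apply: measurableI.
    rewrite -[X in measurable X]setTI.
    by apply: (@measurable_tnth _ (measurableTypeR R)) => //; exact: measurable_itv.
  rewrite -[X in measurable X]setTI.
  exact: (@measurable_behead _ (measurableTypeR R)).
apply: etrans.
  exact: (lebesgueS_setX (lebesgueRn n) (measurable_itv `[_, _]) mB).
rewrite muB lebesgue_measure_itv/= lte_fin ltrDl r0 -EFinD addrAC subrr add0r.
by rewrite -EFinM exprS.
Qed.

Section oscillation.
Local Open Scope ereal_scope.
Context {R : realType} {n : nat}.
Let mu := @lebesgueRn R n.
Implicit Types (f : Rn R n -> R) (g : Rn R n -> \bar R) (Q : set (Rn R n)).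

Definition mean f Q : R :=
  ((fine (mu Q))^-1 * \int[mu]_(x in Q) f x)%R.

Definition mean_osc f Q : \bar R :=
  ((fine (mu Q))^-1)%:E * \int[mu]_(x in Q) `|f x - mean f Q|%:E.

Definition distrib Q0 g (tau : R) : \bar R :=
  mu [set x | Q0 x /\ tau%:E < `|g x|].

Definition rearrangement_lt1 Q0 g (t : R) : \bar R :=
  ereal_inf [set tau%:E | tau in
    [set tau : R | (0 < tau)%R /\ distrib Q0 g tau <= t%:E]].

(* The infimum above always vanishes at t = 1 when Q0 has measure 1, hence the
   separate convention there. *)
Definition rearrangement Q0 g (t : R) : \bar R :=
  if (t < 1)%R then rearrangement_lt1 Q0 g t
  else lim (rearrangement_lt1 Q0 g s @[s --> (1%R : R)^'-]).

Definition S_sharp (p : set (set (Rn R n))) f (x : Rn R n) : \bar R :=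
  \esum_(Q in p) (mean_osc f Q * (\1_Q x)%:E).

Definition F_sharp Q0 f (t : R) : \bar R :=
  ereal_sup [set rearrangement Q0 (S_sharp p f) t | p in packing Q0].

End oscillation.

(* eqV is the equality of the ambient space; it lets V consist of
   representatives of the elements of a quotient. *)
Definition Kfunctional (R : realType) (V : zmodType) (eqV : V -> V -> Prop)
    (A0 A1 : set V) (N0 N1 : V -> \bar R) (t : R) (f : V) : \bar R :=
  ereal_inf [set (N0 g.1 + t%:E * N1 g.2)%E | g in
    [set g : V * V | [/\ A0 g.1, A1 g.2 & eqV f (g.1 + g.2)]]].

Section L1_BMO.
Local Open Scope ereal_scope.
Context {R : realType} {n : nat}.
Let mu := @lebesgueRn R n.
Variable Q0 : set (Rn R n).
Implicit Types f g : Rn R n -> R.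

Definition L1 : set (Rn R n -> R) :=
  [set f | mu.-integrable Q0 (EFin \o f)].

Definition L1_norm_mod_cst f : \bar R :=
  ereal_inf [set \int[mu]_(x in Q0) `|f x - c|%:E | c in [set: R]].

Definition BMO_norm f : \bar R :=
  ereal_sup [set mean_osc f Q | Q in subcube Q0].

Definition BMO : set (Rn R n -> R) :=
  [set f | L1 f /\ BMO_norm f < +oo].

(* Equality of the classes of f and g in the quotient of L^1(Q0) by the
   constant functions. *)
Definition ae_eq_mod_cst f g : Prop :=
  exists c : R, {ae mu, forall x, Q0 x -> f x = (g x + c)%R}.

Definition K_L1_BMO (t : R) f : \bar R :=
  Kfunctional ae_eq_mod_cst L1 BMO L1_norm_mod_cst BMO_norm t f.

End L1_BMO.

(* Main.v *)
(* Lower bound: for f = g0 + g1 + c, a cube on which f oscillates more than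
   2 ||g1||_BMO + s satisfies s |Q| <= 2 int_Q |g0 - c0|; summing over the
   cubes of a packing gives Chebyshev's inequality for S_sharp.

   Upper bound: if t >= 3^-n, then f itself is a good enough first component.
   Otherwise let lam > F(t) and let E be the union of the cubes of a countable
   family of grids on which f oscillates more than lam.  Disjoint such cubes
   form a packing, of total measure at most t, so that |E| <= 3^n t by Vitali's
   covering lemma.  Replacing f by its means on the cells of a dyadic Whitney
   decomposition of E gives g1: each Whitney cell lies in a comparable cube
   meeting the complement of E, hence of oscillation at most lam, so that
   ||f - g1||_1 <= C lam |E| and ||g1||_BMO <= C lam. *)
Require Import Defs.
From mathcomp Require Import all_boot all_order all_algebra.
From mathcomp Require Import all_classical all_reals all_analysis.
From mathcomp Require Import measurable_realfun lra zify.
Set Implicit Arguments.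
Unset Strict Implicit.
Unset Printing Implicit Defensive.
Import Order.TTheory GRing.Theory Num.Theory.
Import numFieldNormedType.Exports.
Local Open Scope classical_set_scope.
Local Open Scope ring_scope.

(** * Integrals and means *)

Section general_integral.
Local Open Scope ereal_scope.
Context {d : measure_display} {T : measurableType d} {R : realType}.
Variable mu : {measure set T -> \bar R}.
Implicit Types (A : set T) (f : T -> R).

(** Three obstacles shape the details. The cubes of a packing are disjoint only up to faces, so sums
    over a packing are carried by the interiors, the faces forming a null set. The set of large
    oscillation must be measurable and yet catch every small ball that matters: testing only
    countably many grid cubes achieves both, at the price of a factor 8 between the radius of a ball
    and the side of a grid cube containing it. Finally, a Whitney decomposition of [E] needs a point
    of [Q0] outside [E]; the bound [3^n t < 1] on |E| supplies it, which is the origin of the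
    threshold. For larger [t] the packing reduced to [Q0] suffices, because then [1 <= 3^n t]. *)

Lemma measurable_absB A f (c : R) : measurable_fun A f ->
  measurable_fun A (fun x => `|f x - c|%:E : \bar R).
Proof.
move=> mf; apply/measurable_EFinP; apply: measurableT_comp => //.
exact: measurable_funB.
Qed.

Lemma le_integral_bigcup (F : (set T)^nat) (f g : T -> \bar R) :
  (forall k, measurable (F k)) -> trivIset setT F ->
  measurable_fun (\bigcup_k F k) f -> measurable_fun (\bigcup_k F k) g ->
  (forall x, 0 <= f x) -> (forall x, 0 <= g x) ->
  (forall k, \int[mu]_(x in F k) f x <= \int[mu]_(x in F k) g x) ->
  \int[mu]_(x in \bigcup_k F k) f x <= \int[mu]_(x in \bigcup_k F k) g x.
Proof.
move=> mF tF mf mg f0 g0 fg.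
rewrite !ge0_integral_bigcup//; apply: lee_nneseries => [k _ _|k _].
  by apply: integral_ge0.
exact: fg.
Qed.

Lemma mean_sub_le A f (c : R) : measurable A -> 0 < mu A < +oo ->
  mu.-integrable A (EFin \o f) ->
  `|(fine (mu A))^-1 * (\int[mu]_(x in A) f x)%R - c|%:E * mu A <=
  \int[mu]_(x in A) `|f x - c|%:E.
Proof.
move=> mA /andP[A0 Aoo] fi.
have Afin : mu A \is a fin_num by rewrite ge0_fin_numE.
have m0 : (0 < fine (mu A))%R by rewrite fine_gt0// A0.
have ci : mu.-integrable A (EFin \o cst c).
  apply/integrableP; split; first exact/measurable_EFinP.
  rewrite (eq_integral (cst `|c|%:E))// integral_cst//.
  by rewrite lte_mul_pinfty.
have fci : mu.-integrable A (EFin \o (fun x => f x - c)%R).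
  by have := integrableB mA fi ci; apply: eq_integrable.
have := le_normr_Rintegral mA fci.
rewrite RintegralB// Rintegral_cst// -lee_fin.
have -> : (\int[mu]_(t in A) `|f t - c|)%R%:E = \int[mu]_(x in A) `|f x - c|%:E.
  rewrite /Rintegral fineK//.
  exact: (integrable_fin_num mA (integrable_abse fci)).
apply: le_trans.
rewrite -{2}(fineK Afin) -EFinM lee_fin.
rewrite -{2}(gtr0_norm m0) -normrM mulrBl mulrAC mulVf ?mul1r//.
by rewrite gt_eqF.
Qed.

(** In the triangle inequality through [c], the distance from the mean to [c] costs a second copy of
    the integral ([mean_sub_le]). Oscillations may thus be estimated against any convenient
    constant. *)
Lemma integral_sub_mean_le A f (c : R) : measurable A -> 0 < mu A < +oo ->
  mu.-integrable A (EFin \o f) ->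
  \int[mu]_(x in A)
    `|f x - (fine (mu A))^-1 * (\int[mu]_(x in A) f x)%R|%:E <=
  2%:E * \int[mu]_(x in A) `|f x - c|%:E.
Proof.
move=> mA A0 fi; set m := (_ * _)%R.
have mf : measurable_fun A f by apply/measurable_EFinP; exact: measurable_int fi.
have I := mean_sub_le c mA A0 fi.
rewrite (_ : 2%:E = 1 + 1)// ge0_muleDl// mul1e.
apply: le_trans (leeD2l _ I); rewrite -[(_ * mu A)](integral_cst mu mA).
rewrite -ge0_integralD//; last 2 first.
  exact: measurable_absB.
  by move=> x _; rewrite lee_fin.
apply: ge0_le_integral => //.
- exact: measurable_absB.
- by apply: emeasurable_funD => //; exact: measurable_absB.
- move=> x _; rewrite /= -EFinD lee_fin.
  by rewrite (le_trans (ler_distD c _ _))// (distrC c).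
Qed.
End general_integral.

(** * Cubes *)

Section coordinates.
Context {R : realType} {n : nat}.
Implicit Types (a x y : Rn R n) (r : R).
Local Notation mu := (@lebesgueRn R n).

Definition xcoord x i : R := tnth x i.

Lemma measurable_xcoord i : measurable_fun setT (xcoord^~ i).
Proof. exact: (@measurable_tnth _ (measurableTypeR R)). Qed.

Lemma cubeE a r x : cube a r x <->
  forall i, xcoord a i <= xcoord x i <= xcoord a i + r.
Proof. by []. Qed.

Definition mkpt (g : 'I_n -> R) : Rn R n := [tuple of mktuple g].

Lemma xcoord_mkpt g i : xcoord (mkpt g) i = g i.
Proof. by rewrite /xcoord tnth_mktuple. Qed.

Definition ocube a r : set (Rn R n) :=
  [set x | forall i, xcoord a i < xcoord x i < xcoord a i + r].

Lemma ocube_sub_cube a r : ocube a r `<=` cube a r.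
Proof. by move=> x ax i; have /andP[/ltW ? /ltW ?] := ax i; apply/andP. Qed.

Lemma measurable_cube a r : measurable (cube a r).
Proof.
rewrite (_ : cube a r = \bigcap_(i in [set: 'I_n])
    [set x | (xcoord a i <= xcoord x i <= xcoord a i + r)%R]).
  apply: fin_bigcap_measurable => // i _.
  rewrite -[X in measurable X]setTI.
  have := measurable_xcoord i measurableT
    (measurable_itv `[xcoord a i, xcoord a i + r]).
  by congr (measurable (_ `&` _)); apply/seteqP; split => x; rewrite /= in_itv.
by apply/seteqP; split => [x + i _|x + i]; apply.
Qed.

Lemma measurable_ocube a r : measurable (ocube a r).
Proof.
rewrite (_ : ocube a r = \bigcap_(i in [set: 'I_n])
    [set x | (xcoord a i < xcoord x i < xcoord a i + r)%R]).
  apply: fin_bigcap_measurable => // i _.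
  rewrite -[X in measurable X]setTI.
  have := measurable_xcoord i measurableT
    (measurable_itv `]xcoord a i, xcoord a i + r[).
  by congr (measurable (_ `&` _)); apply/seteqP; split => x; rewrite /= in_itv.
by apply/seteqP; split => [x + i _|x + i]; apply.
Qed.

Lemma measure_cube a r : 0 < r -> mu (cube a r) = (r ^+ n)%:E.
Proof. by move=> r0; have [] := lebesgueRn_cube a r0. Qed.

Lemma ocube_interior a r : 0 < r -> interiorRn (cube a r) = ocube a r.
Proof.
move=> r0; apply/seteqP; split => x.
  move=> [e e0 xe] i.
  (* Shifting all coordinates by [e / 2], down and then up, stays in the cube and makes both
     inequalities strict. *)
  have /(_ i) : cube a r (mkpt (fun j => xcoord x j - e / 2)).
    apply: xe => j; rewrite -!/(xcoord _ _) xcoord_mkpt.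
    by rewrite opprB addrC subrK gtr0_norm; lra.
  have /(_ i) : cube a r (mkpt (fun j => xcoord x j + e / 2)).
    apply: xe => j; rewrite -!/(xcoord _ _) xcoord_mkpt.
    by rewrite opprD addrA subrr add0r normrN gtr0_norm; lra.
  rewrite -!/(xcoord _ _) !xcoord_mkpt.
  by lra.
move=> xa.
(* The distance from [x] to the nearest face, capped by the positive seed [r]. *)
pose m := \big[Order.min/r]_i
  Order.min (xcoord x i - xcoord a i) (xcoord a i + r - xcoord x i).
exists m.
  rewrite /m; elim/big_ind : _ => // [y z y0 z0|i _]; rewrite lt_min.
    by rewrite y0.
  by have := xa i; lra.
move=> y xy; apply/cubeE => i; have := xy i; rewrite -!/(xcoord _ _) => yi.
have : m <= Order.min (xcoord x i - xcoord a i) (xcoord a i + r - xcoord x i).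
  exact: bigmin_le.
by rewrite le_min; move: yi; rewrite ltr_norml; lra.
Qed.

(** The lower bound is by exhaustion: concentric closed cubes of side [r * (1 - u)] lie in the open
    cube, and Bernoulli's inequality bounds the lost volume by [n * u * r^n]. *)
Lemma measure_ocube a r : 0 < r -> mu (ocube a r) = (r ^+ n)%:E.
Proof.
move=> r0; apply/eqP; rewrite eq_le; apply/andP; split.
  rewrite -(measure_cube a r0) le_measure ?inE//.
  - exact: measurable_ocube.
  - exact: measurable_cube.
  - exact: ocube_sub_cube.
have bern (u : R) k : 0 <= u <= 1 -> 1 - k%:R * u <= (1 - u) ^+ k.
  move=> u01; elim: k => [|k IH]; first by rewrite mul0r subr0.
  rewrite exprS -natr1; apply: (@le_trans _ _ ((1 - u) * (1 - k%:R * u))).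
    by have : 0 <= k%:R :> R by []; nra.
  by rewrite ler_wpM2l//; lra.
apply/lee_addgt0Pr => e e0.
have rn0 : 0 < r ^+ n by rewrite exprn_gt0.
(* With [u = e / c / 2], this [c] ensures both [u < 1] and [n * u * r^n <= e]. *)
pose c := n%:R * r ^+ n + e + 1.
have c0 : 0 < c by rewrite /c ltr_wpDl// addr_ge0 ?mulr_ge0// ltW.
have c1 : e / c <= 1.
  by rewrite ler_pdivrMr// mul1r /c -addrA addrCA lerDl addr_ge0// ?mulr_ge0// ltW.
have ec0 : 0 < e / c by rewrite divr_gt0.
pose u := e / c / 2.
have u01 : 0 < u /\ u < 1 by rewrite /u; lra.
have r'0 : 0 < r * (1 - u) by rewrite mulr_gt0//; lra.
pose b := mkpt (fun i => xcoord a i + r * u / 2).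
apply: (@le_trans _ _ (mu (cube b (r * (1 - u))) + e%:E)%E).
  rewrite measure_cube// -EFinD lee_fin exprMn.
  have /(ler_wpM2l (ltW rn0)) : 1 - n%:R * u <= (1 - u) ^+ n by apply: bern; lra.
  suff : r ^+ n * (n%:R * u) <= e by lra.
  have -> : r ^+ n * (n%:R * u) = e * ((n%:R * r ^+ n) / c / 2) by rewrite /u; lra.
  rewrite ler_piMr ?ltW//; have : n%:R * r ^+ n / c <= 1.
    by rewrite ler_pdivrMr// mul1r /c -addrA lerDl addr_ge0// ltW.
  have : 0 <= n%:R * r ^+ n / c by rewrite divr_ge0// ?mulr_ge0// ltW.
  lra.
rewrite leeD2r// le_measure ?inE//.
- exact: measurable_cube.
- exact: measurable_ocube.
- move=> x xb i; have := xb i; rewrite -!/(xcoord _ _) xcoord_mkpt; nra.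
Qed.

Lemma measure_cube_boundary a r : 0 < r -> mu (cube a r `\` ocube a r) = 0%E.
Proof.
move=> r0; rewrite measureD//.
- have /setIidPr -> := @ocube_sub_cube a r.
  transitivity (mu (cube a r) - mu (ocube a r))%E => //.
  by rewrite measure_cube// measure_ocube// subee.
- exact: measurable_cube.
- exact: measurable_ocube.
- by have := ltry (r ^+ n); rewrite -(measure_cube a r0).
Qed.

End coordinates.

(** * Sums over packings and rearrangements *)

Section sharp_sum.
Local Open Scope ereal_scope.
Context {R : realType} {n : nat}.
Implicit Types (f : Rn R n -> R) (Q : set (Rn R n)) (p : set (set (Rn R n))).
Local Notation mu := (@lebesgueRn R n).

Lemma mean_osc_ge0 f Q : 0 <= mean_osc f Q.
Proof.
rewrite /mean_osc mule_ge0// ?lee_fin ?invr_ge0 ?fine_ge0//.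
exact: integral_ge0.
Qed.

Lemma S_sharp_ge0 p f x : 0 <= S_sharp p f x.
Proof.
by apply: esum_ge0 => Q _; rewrite mule_ge0 ?mean_osc_ge0// lee_fin.
Qed.

(** Enumerating [p] by a set [B] of integers turns the unordered sum into a series of measurable
    functions. *)
Lemma measurable_S_sharp p f : countable p -> (forall Q, p Q -> measurable Q) ->
  measurable_fun setT (S_sharp p f).
Proof.
move=> /countable_bijP[B]; rewrite card_eq_sym => /card_set_bijP[e eB] mp.
pose h k x := mean_osc f (e k) * (\1_(e k) x)%:E.
have -> : S_sharp p f = fun x =>
    \sum_(0 <= k <oo | k \in [pred k | k \in B]) h k x.
  apply/funext => x; rewrite /S_sharp (reindex_esum B p e)// nneseries_esum.
    by congr esum; apply/seteqP; split => k /=; rewrite inE.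
  by move=> k _; rewrite mule_ge0 ?mean_osc_ge0// lee_fin.
apply: ge0_emeasurable_sum => [k x _ _|k].
  by rewrite mule_ge0 ?mean_osc_ge0// lee_fin.
rewrite inE => Bk.
apply: emeasurable_funM => //; apply/measurable_EFinP.
apply: measurable_indic; apply: mp.
by have [eBp _ _] := eB; apply: eBp; rewrite inE in Bk.
Qed.

Lemma S_sharp_ge p f Q x : p Q -> Q x -> mean_osc f Q <= S_sharp p f x.
Proof.
move=> pQ Qx; rewrite /S_sharp (esumID [set Q]); last first.
  by move=> Q' _; rewrite mule_ge0 ?mean_osc_ge0// lee_fin.
rewrite setIidr; last by move=> _ ->.
have o0 := mean_osc_ge0 f Q.
rewrite esum_set1 ?indicE ?mem_set// ?mule1// leeDl//.
by apply: esum_ge0 => Q' _; rewrite mule_ge0 ?mean_osc_ge0// lee_fin.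
Qed.

(** Off the faces at most one cube of the packing contains [x], so the sum is a single oscillation;
    [0 <= tau] rules out the empty sum. *)
Lemma S_sharp_gt p Q0 f x (tau : R) : (0 <= tau)%R -> packing Q0 p ->
  (forall Q, p Q -> Q x -> interiorRn Q x) -> tau%:E < S_sharp p f x ->
  exists Q, [/\ p Q, interiorRn Q x & tau%:E < mean_osc f Q].
Proof.
move=> tau0 [_ _ pp] px Stau.
have [[Q [pQ Qx]]|nQ] := pselect (exists Q, p Q /\ Q x); last first.
  move: Stau; rewrite /S_sharp esum1 ?lte_fin ?ltNge ?tau0// => Q pQ.
  by rewrite indicE memNset ?mule0// => Qx; apply: nQ; exists Q.
exists Q; split => //; first exact: px.
have o0 := mean_osc_ge0 f Q.
move: Stau; rewrite /S_sharp (esumID [set Q]); last first.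
  by move=> Q' _; rewrite mule_ge0 ?mean_osc_ge0// lee_fin.
rewrite setIidr; last by move=> _ ->.
rewrite esum_set1 ?indicE ?mem_set// ?mule1//.
rewrite esum1 ?adde0// => Q' [pQ' /= QQ'].
rewrite indicE memNset ?mule0// => Q'x.
have : (interiorRn Q `&` interiorRn Q') x by split; exact: px.
by rewrite pp// => QQ; apply: QQ'.
Qed.

End sharp_sum.

Section rearrangement.
Local Open Scope ereal_scope.
Context {R : realType} {n : nat}.
Implicit Types (g : Rn R n -> \bar R) (Q : set (Rn R n)).
Local Notation mu := (@lebesgueRn R n).

Lemma measurable_level_set Q g (tau : R) : measurable Q -> measurable_fun setT g ->
  measurable [set x | Q x /\ tau%:E < `|g x|].
Proof.
move=> mQ mg; apply: measurableI => //; rewrite -[X in measurable X]setTI.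
by apply: emeasurable_fun_o_infty => //; exact: measurableT_comp.
Qed.

Lemma rearrangement_lt1_le Q g (s t : R) : (s <= t)%R ->
  rearrangement_lt1 Q g t <= rearrangement_lt1 Q g s.
Proof.
move=> st; apply: le_ereal_inf => _ [tau [tau0 dtau] <-]; exists tau => //.
by split => //; rewrite (le_trans dtau)// lee_fin.
Qed.

Lemma rearrangement_lt1_cvg Q g :
  cvg (rearrangement_lt1 Q g s @[s --> (1%R : R)^'-]).
Proof.
(* Reflection turns a nonincreasing function near [1] from the left into a nondecreasing one near
   [-1] from the right. *)
pose h := rearrangement_lt1 Q g \o -%R.
have H := @nondecreasing_at_right_cvge R h (-1)%R (BRight 0%R).
apply/cvg_ex; eexists; apply/cvg_at_leftNP; apply: H.
  by rewrite bnd_simp; lra.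
by move=> x y _ _ xy; apply: rearrangement_lt1_le; rewrite lerN2.
Qed.

(** Together with [rearrangement_ge], this absorbs the convention at [t = 1]: the left limit of a
    nonincreasing function lies below all earlier values, hence the strict [s < t]. *)
Lemma rearrangement_le Q g (s t : R) : (s < t <= 1)%R ->
  rearrangement Q g t <= rearrangement_lt1 Q g s.
Proof.
move=> /andP[st t1]; rewrite /rearrangement; case: ifPn => [_|].
  exact/rearrangement_lt1_le/ltW.
rewrite -leNgt => t1'; apply: lime_le; first exact: rearrangement_lt1_cvg.
near=> u; apply: rearrangement_lt1_le; near: u.
by apply: nbhs_left_ge; lra.
Unshelve. all: by end_near. Qed.

Lemma rearrangement_ge Q g (t : R) (l : \bar R) : (t <= 1)%R ->
  (forall s, (s < 1)%R -> l <= rearrangement_lt1 Q g s) ->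
  l <= rearrangement Q g t.
Proof.
move=> t1 lg; rewrite /rearrangement; case: ifPn => [|_]; first exact: lg.
apply: lime_ge; first exact: rearrangement_lt1_cvg.
near=> u; apply: lg; near: u; exact: nbhs_left_lt.
Unshelve. all: by end_near. Qed.

Lemma rearrangement_lt1_ge0 Q g (t : R) : 0 <= rearrangement_lt1 Q g t.
Proof. by apply/ereal_infP => _ [tau [tau0 _] <-]; rewrite lee_fin ltW. Qed.

End rearrangement.

(** * The lower bound *)

Section mean_oscillation.
Local Open Scope ereal_scope.
Context {R : realType} {n : nat}.
Implicit Types (f g : Rn R n -> R) (A Q : set (Rn R n)).
Local Notation mu := (@lebesgueRn R n).

Lemma mean_oscE f A : 0 < mu A < +oo ->
  \int[mu]_(x in A) `|f x - mean f A|%:E = mean_osc f A * mu A.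
Proof.
move=> /andP[A0 Aoo].
have Afin : mu A \is a fin_num by rewrite ge0_fin_numE.
rewrite /mean_osc muleC muleA -[in X in X * _](fineK Afin) -EFinM mulfV ?mul1e//.
by rewrite gt_eqF// fine_gt0// A0.
Qed.

Lemma mean_osc_mul_le f A (c : R) : measurable A -> 0 < mu A < +oo ->
  mu.-integrable A (EFin \o f) ->
  mean_osc f A * mu A <= 2%:E * \int[mu]_(x in A) `|f x - c|%:E.
Proof.
by move=> mA A0 fi; rewrite -mean_oscE//; exact: integral_sub_mean_le.
Qed.

Lemma mean_osc_le f A (c l : R) : measurable A -> 0 < mu A < +oo ->
  mu.-integrable A (EFin \o f) ->
  2%:E * \int[mu]_(x in A) `|f x - c|%:E <= l%:E * mu A -> mean_osc f A <= l%:E.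
Proof.
move=> mA /[dup] A0 /andP[A0' Aoo] fi H.
have := le_trans (mean_osc_mul_le c mA A0 fi) H.
by rewrite lee_pmul2r// ge0_fin_numE.
Qed.

Lemma integrable_absB_fin f A (c : R) : measurable A -> mu A < +oo ->
  mu.-integrable A (EFin \o f) ->
  \int[mu]_(x in A) `|f x - c|%:E \is a fin_num.
Proof.
move=> mA Aoo fi; have mf : measurable_fun A f.
  by apply/measurable_EFinP; exact: measurable_int fi.
rewrite ge0_fin_numE ?integral_ge0//.
apply: (@le_lt_trans _ _ (\int[mu]_(x in A) (`|f x|%:E + cst `|c|%:E x))).
  apply: ge0_le_integral => //; first exact: measurable_absB.
    apply: emeasurable_funD => //; apply/measurable_EFinP.
    exact: measurableT_comp.
  by move=> x _; rewrite -EFinD lee_fin ler_normB.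
rewrite ge0_integralD//; last 2 first.
  by apply/measurable_EFinP; exact: measurableT_comp.
  by move=> x _; rewrite lee_fin.
rewrite integral_cst// lte_add_pinfty//; last by rewrite lte_mul_pinfty.
by have /integrableP[_] := fi.
Qed.

Lemma measurable_fun_L1 a (r : R) f A : L1 (cube a r) f -> A `<=` cube a r ->
  measurable_fun A f.
Proof.
move=> fL AQ; apply: (measurable_funS _ AQ); first exact: measurable_cube.
by apply/measurable_EFinP; exact: measurable_int fL.
Qed.

End mean_oscillation.

Section lower_bound.
Local Open Scope ereal_scope.
Context {R : realType} {n : nat}.
Local Notation mu := (@lebesgueRn R n).
Variables (a : Rn R n) (r : R).
Let Q0 := cube a r.

Let measurable_subcube Q : subcube Q0 Q -> measurable Q.
Proof. by move=> [[b [s [s0 ->]]] _]; exact: measurable_cube. Qed.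

Let measure_subcube Q : subcube Q0 Q -> 0 < mu Q < +oo.
Proof.
by move=> [[b [s [s0 ->]]] _]; rewrite measure_cube// lte_fin exprn_gt0//= ltry.
Qed.

Variables (f g0 g1 : Rn R n -> R) (c c0 B N : R).
Hypotheses (fL : L1 Q0 f) (g0L : L1 Q0 g0) (g1L : L1 Q0 g1).
Hypothesis fE : {ae mu, forall x, Q0 x -> f x = (g0 x + g1 x + c)%R}.
Hypothesis BE : BMO_norm Q0 g1 = B%:E.
Hypothesis NE : \int[mu]_(x in Q0) `|g0 x - c0|%:E = N%:E.

Let L1_sub h Q : L1 Q0 h -> subcube Q0 Q -> mu.-integrable Q (EFin \o h).
Proof.
move=> hL QQ0; apply: integrableS hL => //; last by case: QQ0.
- exact: measurable_cube.
- exact: measurable_subcube.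
Qed.

Let mL h A : L1 Q0 h -> A `<=` Q0 -> measurable_fun A h.
Proof. exact: measurable_fun_L1. Qed.

(* Comparing f with the constant c + c0 + mean g1 Q rather than with its own
   mean costs a factor 2. *)
Lemma big_oscillation_le (s : R) Q : subcube Q0 Q ->
  (2 * B + s)%:E < mean_osc f Q ->
  s%:E * mu Q <= 2%:E * \int[mu]_(x in Q) `|g0 x - c0|%:E.
Proof.
move=> QQ0 sQ.
have mQ := measurable_subcube QQ0.
have muQ := measure_subcube QQ0; have /andP[muQ0 muQoo] := muQ.
have QQ : Q `<=` Q0 by case: QQ0.
have muQf : mu Q \is a fin_num by rewrite ge0_fin_numE.
have fQ := L1_sub fL QQ0; have g0Q := L1_sub g0L QQ0; have g1Q := L1_sub g1L QQ0.
have mf := mL fL QQ; have mg0 := mL g0L QQ; have mg1 := mL g1L QQ.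
set m := mean g1 Q.
have H1 : (2 * B + s)%:E * mu Q <=
    2%:E * \int[mu]_(x in Q) `|f x - (c + c0 + m)|%:E.
  apply: le_trans (mean_osc_mul_le _ mQ muQ fQ).
  by rewrite lee_wpmul2r// ltW.
have H2 : \int[mu]_(x in Q) `|f x - (c + c0 + m)|%:E <=
    \int[mu]_(x in Q) `|g0 x - c0|%:E + \int[mu]_(x in Q) `|g1 x - m|%:E.
  rewrite -ge0_integralD//; try exact: measurable_absB.
  apply: ae_ge0_le_integral => //; first exact: measurable_absB.
    by move=> x _; rewrite adde_ge0.
    by apply: emeasurable_funD; exact: measurable_absB.
  apply: filterS fE => x fx Qx; rewrite -EFinD lee_fin fx; last exact: QQ.
  rewrite (_ : _ - _ = (g0 x - c0) + (g1 x - m))%R; first exact: ler_normD.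
  by lra.
have H3 : \int[mu]_(x in Q) `|g1 x - m|%:E <= B%:E * mu Q.
  rewrite mean_oscE// lee_wpmul2r// -BE; apply: le_ereal_sup_tmp.
  by exists (mean_osc g1 Q) => //; exists Q.
(* All quantities being finite, [2 * B * mu Q] can be cancelled between [H1] and twice [H3]. *)
have := integrable_absB_fin c0 mQ muQoo g0Q.
have := integrable_absB_fin m mQ muQoo g1Q.
have := integrable_absB_fin (c + c0 + m)%R mQ muQoo fQ.
move: H1 H2 H3 muQf.
case: (mu Q) => // M; do 3 case: (\int[mu]_(x in Q) _) => //.
by move=> u v w; rewrite -!EFinM -EFinD !lee_fin => *; lra.
Qed.

Lemma distrib_S_sharp_le (p : set (set (Rn R n))) (s : R) : packing Q0 p ->
  (0 < s)%R -> (0 <= B)%R ->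
  distrib Q0 (S_sharp p f) (2 * B + s) <= (2 * N / s)%:E.
Proof.
move=> pp s0 B0; have [pc pQ0 _] := pp.
have mp Q : p Q -> measurable Q by move=> /pQ0 /measurable_subcube.
have mS := measurable_S_sharp f pc mp.
have mQ0 : measurable Q0 by exact: measurable_cube.
move: (pc) => /countable_bijP[I]; rewrite card_eq_sym.
move=> /card_set_bijP[e [eI einj esurj]].
have cubeE k : I k -> exists b u, (0 < u)%R /\ e k = cube b u.
  by move=> Ik; have [[b [u [u0 ->]]] _] := pQ0 _ (eI _ Ik); exists b, u.
(* The [F k] are disjoint, so integrals over them add up; the faces [Z k] are negligible, and
   outside them the level set is covered by the [F k]. *)
pose F k := if `[< I k /\ (2 * B + s)%:E < mean_osc f (e k) >]
  then interiorRn (e k) else set0.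
pose Z k := if `[< I k >] then e k `\` interiorRn (e k) else set0.
have mF k : measurable (F k).
  rewrite /F; case: asboolP => [[Ik _]|//].
  have [b [u [u0 ->]]] := cubeE _ Ik.
  by rewrite ocube_interior//; exact: measurable_ocube.
have FQ0 : \bigcup_k F k `<=` Q0.
  move=> x [k _]; rewrite /F; case: asboolP => [[Ik _]|//].
  have [b [u [u0 ek]]] := cubeE _ Ik.
  rewrite ek ocube_interior// => /ocube_sub_cube; rewrite -ek.
  by have [_] := pQ0 _ (eI _ Ik); apply.
have Z0 k : mu.-negligible (Z k).
  rewrite /Z; case: asboolP => [Ik|_]; last exact: negligible_set0.
  have [b [u [u0 ->]]] := cubeE _ Ik; rewrite ocube_interior//.
  apply/negligibleP; last exact: measure_cube_boundary.
  by apply: measurableD; [exact: measurable_cube|exact: measurable_ocube].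
have [W [mW W0 ZW]] := negligible_bigcup Z0.
have UF : measurable (\bigcup_k F k) by exact: bigcupT_measurable.
have step : distrib Q0 (S_sharp p f) (2 * B + s) <= mu (\bigcup_k F k).
  rewrite -[leRHS]adde0 -W0; apply: (le_trans _ (measureU2 _ UF mW)).
  apply: le_measure; rewrite ?inE.
  - exact: measurable_level_set.
  - exact: measurableU.
  move=> x [Q0x]; rewrite gee0_abs ?S_sharp_ge0// => Sx.
  have [Wx|nWx] := pselect (W x); first by right.
  left; have [|Q pQ xQ|Q [pQ Qx oQ]] := S_sharp_gt _ pp _ Sx.
  - by rewrite addr_ge0// ?mulr_ge0// ltW.
  - apply: contrapT => Qx; apply: nWx; apply: ZW.
    have [k Ik ek] := esurj _ pQ; exists k => //.
    by rewrite /Z; case: asboolP => // _; rewrite ek.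
  - have [k Ik ek] := esurj _ pQ; exists k => //.
    by rewrite /F; case: asboolP => [_|[]]; rewrite ek.
apply: (le_trans step).
have H : s%:E * mu (\bigcup_k F k) <= (2 * N)%:E.
  rewrite -integral_cst// EFinM -NE -ge0_integralZl_EFin//; last first.
    by apply: measurable_absB; exact: mL.
  apply: (@le_trans _ _ (\int[mu]_(x in \bigcup_k F k) (2%:E * `|g0 x - c0|%:E))).
    apply: le_integral_bigcup => //.
    - move=> i j _ _ [x []]; rewrite /F.
      case: asboolP => // -[Ii _] xi; case: asboolP => // -[Ij _] xj.
      have [_ _ pd] := pp.
      apply: contrapT => ij; suff : (interiorRn (e i) `&` interiorRn (e j)) x.
        rewrite pd//; [exact: eI|exact: eI|].
        by move/einj; rewrite !inE => /(_ Ii Ij).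
      by [].
    - by apply: measurable_funeM; (apply: measurable_absB; exact: mL).
    - by move=> x; rewrite lee_fin ltW.
    move=> k; rewrite integral_cst//.
    rewrite /F; case: asboolP => [[Ik ok]|_]; last first.
      by rewrite measure0 mule0 integral_set0.
    have sk := pQ0 _ (eI _ Ik).
    have [b [u [u0 ek]]] := cubeE _ Ik.
    have ekQ0 : cube b u `<=` Q0 by rewrite -ek; case: sk.
    have := big_oscillation_le sk ok; rewrite ek ocube_interior// => H.
    apply: (@le_trans _ _ (s%:E * mu (cube b u))).
      by rewrite (measure_cube b u0) -(measure_ocube b u0).
    apply: (le_trans H).
    rewrite -ge0_integralZl_EFin//; last 2 first.
      exact: measurable_cube.
      by apply: measurable_absB; exact: mL.
    rewrite (@ge0_negligible_integral _ _ _ _ _ (cube b u `\` ocube b u))//.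
    - by rewrite setDD setIidr//; exact: ocube_sub_cube.
    - by apply: measurableD; [exact: measurable_cube|exact: measurable_ocube].
    - exact: measurable_cube.
    - by apply: measurable_funeM; (apply: measurable_absB; exact: mL).
    - exact: measure_cube_boundary.
  apply: ge0_subset_integral => //.
  - by apply: measurable_funeM; (apply: measurable_absB; exact: mL).
by rewrite mulrC EFinM lee_pdivlMl.
Qed.

Lemma F_sharp_le (t : R) : (0 < t <= 1)%R -> (0 <= B)%R -> (0 <= N)%R ->
  F_sharp Q0 f t <= (2 * B + 4 * N / t)%:E.
Proof.
move=> /andP[t0 t1] B0 N0; apply/ereal_supP => _ [p pp <-].
apply/lee_addgt0Pr => e e0; rewrite -EFinD -addrA.
(* With [s = 4 * N / t + e], Chebyshev's bound [2 * N / s] is at most [t / 2]; evaluating at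
   [t / 2 < t] also covers [t = 1], and [e] keeps [s] positive when [N = 0]. *)
have s0 : (0 < 4 * N / t + e)%R by rewrite ltr_wpDl// divr_ge0 ?mulr_ge0// ltW.
apply: (@le_trans _ _ (rearrangement_lt1 Q0 (S_sharp p f) (t / 2))).
  by apply: rearrangement_le; lra.
apply: ge_ereal_inf; exists (2 * B + (4 * N / t + e))%:E => //.
exists (2 * B + (4 * N / t + e))%R => //; split.
  by rewrite ltr_wpDl// mulr_ge0.
rewrite (le_trans (distrib_S_sharp_le pp s0 B0))// lee_fin ler_pdivrMr//.
have : (0 <= e * t)%R by rewrite mulr_ge0 ?ltW.
rewrite (_ : t / 2 * (4 * N / t + e) = 2 * N * (t / t) + e * t / 2)%R; last by lra.
by rewrite divff ?gt_eqF//; lra.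
Qed.

End lower_bound.

Section Kfunctional_bounds.
Local Open Scope ereal_scope.
Context {R : realType} {n : nat}.
Local Notation mu := (@lebesgueRn R n).
Variables (a : Rn R n) (r : R).
Hypothesis r0 : (0 < r)%R.
Let Q0 := cube a r.

Lemma BMO_norm_ge0 f : 0 <= BMO_norm Q0 f.
Proof.
apply: le_ereal_sup_tmp; exists (mean_osc f Q0); last exact: mean_osc_ge0.
by exists Q0 => //; split => //; exists a, r.
Qed.

Lemma F_sharp_ge0 f t : 0 <= F_sharp Q0 f t.
Proof.
apply: le_ereal_sup_tmp; exists (rearrangement Q0 (S_sharp set0 f) t).
  by exists set0.
rewrite /rearrangement; case: ifPn => [_|_]; first exact: rearrangement_lt1_ge0.
apply: lime_ge; first exact: rearrangement_lt1_cvg.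
by apply: nearW => s; exact: rearrangement_lt1_ge0.
Qed.

Lemma F_sharp_le_K f t : L1 Q0 f -> (0 < t <= 1)%R ->
  (4^-1 * t)%:E * F_sharp Q0 f t <= K_L1_BMO Q0 t f.
Proof.
move=> fL t01; apply/ereal_infP => _ [[g0 g1] /= [g0L [g1L g1B] [c fE]] <-].
have /andP[t0 t1] := t01.
have Bfin : BMO_norm Q0 g1 \is a fin_num by rewrite ge0_fin_numE// BMO_norm_ge0.
set B := fine (BMO_norm Q0 g1).
have BE : BMO_norm Q0 g1 = B%:E by rewrite fineK.
have B0 : (0 <= B)%R by rewrite -lee_fin -BE BMO_norm_ge0.
rewrite BE -EFinM -leeBlDr//; apply/ereal_infP => _ [c0 _ <-]; rewrite leeBlDr//.
have mQ0 : measurable Q0 := measurable_cube a r.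
have Q0oo : mu Q0 < +oo by rewrite measure_cube// ltry.
have Nfin := integrable_absB_fin c0 mQ0 Q0oo g0L.
set N := fine (\int[mu]_(x in Q0) `|g0 x - c0|%:E).
have NE : \int[mu]_(x in Q0) `|g0 x - c0|%:E = N%:E by rewrite fineK.
have N0 : (0 <= N)%R by rewrite -lee_fin -NE integral_ge0.
have FH := F_sharp_le fL g0L g1L fE BE NE t01 B0 N0.
apply: (@le_trans _ _ ((4^-1 * t)%:E * (2 * B + 4 * N / t)%:E)).
  by rewrite lee_wpmul2l// lee_fin mulr_ge0 ?invr_ge0// ltW.
rewrite NE -EFinM -EFinD lee_fin.
(* The factor 4 in front of [N] in [F_sharp_le] dictates the constant [4^-1]. *)
rewrite (_ : _ * _ = t * B / 2 + N * (t / t))%R; last by lra.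
by rewrite divff ?gt_eqF//; have := mulr_ge0 (ltW t0) B0; lra.
Qed.

Hypothesis Q01 : mu Q0 = 1.

(** For the packing reduced to [Q0], every level below the oscillation is exceeded on all of [Q0], a
    set of measure 1, which is more than any [s < 1]. *)
Lemma mean_osc_le_F_sharp f t : (t <= 1)%R -> mean_osc f Q0 <= F_sharp Q0 f t.
Proof.
move=> t1; apply: le_ereal_sup_tmp; exists (rearrangement Q0 (S_sharp [set Q0] f) t).
  exists [set Q0] => //; split => //.
  - by move=> _ ->; split => //; exists a, r.
  - by move=> _ _ -> ->.
apply: rearrangement_ge => // s s1; apply/ereal_infP => _ [tau [tau0 Dtau] <-].
rewrite leNgt; apply/negP => tauQ; move: Dtau; apply/negP; rewrite -ltNge.
rewrite (_ : distrib _ _ _ = 1) ?lte_fin// -Q01; congr (mu _).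
apply/seteqP; split => [x []//|x Q0x]; split => //.
rewrite gee0_abs ?S_sharp_ge0// (lt_le_trans tauQ)//.
exact: S_sharp_ge.
Qed.

(** The decomposition [f = f + 0], with the mean of [f] as the constant factored out. *)
Lemma K_le_mean_osc f t : L1 Q0 f -> (0 < t)%R ->
  K_L1_BMO Q0 t f <= mean_osc f Q0.
Proof.
move=> fL t0.
have osc0 Q : mean_osc (cst 0%R : Rn R n -> R) Q = 0.
  rewrite /mean_osc /mean /Rintegral integral0 mulr0.
  under eq_integral do rewrite subrr normr0.
  by rewrite integral0 mule0.
have BMO0 : BMO_norm Q0 (cst 0%R : Rn R n -> R) = 0.
  apply/eqP; rewrite eq_le BMO_norm_ge0 andbT.
  by apply/ereal_supP => _ [Q _ <-]; rewrite osc0.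
apply: ge_ereal_inf; exists (L1_norm_mod_cst Q0 f + t%:E * BMO_norm Q0 (cst 0%R)).
  exists (f, cst 0%R) => //; split => //.
  - by split; [exact: integrable0|rewrite BMO0 ltry].
  - by exists 0%R; apply: aeW => x _; rewrite /= !addr0.
rewrite BMO0 mule0 adde0; apply: ge_ereal_inf.
exists (\int[mu]_(x in Q0) `|f x - mean f Q0|%:E); first by exists (mean f Q0).
by rewrite mean_oscE ?Q01 ?mule1// lte01 ltry.
Qed.

End Kfunctional_bounds.

(** * Covering by grid cubes *)

Section vitali.
Context {R : realType} {n : nat}.
Implicit Types (x y z : Rn R n) (e : R).
Local Notation mu := (@lebesgueRn R n).

Definition supclose e x y := forall i, `|xcoord x i - xcoord y i| <= e.

Lemma supclose_sym e x y : supclose e x y -> supclose e y x.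
Proof. by move=> xy i; rewrite distrC. Qed.

Lemma supclose_trans e e' x y z : supclose e x y -> supclose e' y z ->
  supclose (e + e') x z.
Proof.
by move=> xy yz i; rewrite (le_trans (ler_distD (xcoord y i) _ _))// lerD.
Qed.

Lemma supclose_le e e' x y : e <= e' -> supclose e x y -> supclose e' x y.
Proof. by move=> ee' xy i; rewrite (le_trans (xy i)). Qed.

Lemma supclose_cube (b : Rn R n) e x y : cube b e x ->
  cube b e y -> supclose e x y.
Proof.
move=> /cubeE bx /cubeE yb i; have := bx i; have := yb i.
by rewrite ler_norml; lra.
Qed.

Lemma cube_sub_triple (b : Rn R n) e (b' : Rn R n) e' : e <= e' ->
  cube b e `&` cube b' e' !=set0 ->
  cube b e `<=` cube (mkpt (fun i => xcoord b' i - e')) (3 * e').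
Proof.
move=> ee' [z [bz bz']] x bx; apply/cubeE => i; rewrite xcoord_mkpt.
move: bz bz' bx => /cubeE/(_ i) + /cubeE/(_ i) + /cubeE/(_ i).
by lra.
Qed.

(** Greedy selection: keep a largest cube, discard those meeting it, which its triple contains, and
    recurse on the rest. *)
Lemma vitali_cubes (I : eqType) (b : I -> Rn R n) (rho : I -> R) (s : seq I) :
  (forall i, 0 < rho i) ->
  exists D : seq I, [/\ uniq D, {subset D <= s},
    {in D &, forall i j, i <> j ->
      cube (b i) (rho i) `&` cube (b j) (rho j) = set0} &
    {in s, forall i, exists2 j, j \in D & cube (b i) (rho i) `<=`
      cube (mkpt (fun k => xcoord (b j) k - rho j)) (3 * rho j)}].
Proof.
move=> rho0; have [N] := ubnP (size s); elim: N s => // N IH s sN.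
have [->|s0] := eqVneq s [::]; first by exists [::].
have [i0 i0s i0max] : exists2 i, i \in s & {in s, forall j, rho j <= rho i}.
  elim: s s0 {sN} => // i s IHs _; have [->|/IHs[j js jmax]] := eqVneq s [::].
    by exists i; rewrite ?mem_head// => j; rewrite inE => /eqP ->.
  have [ij|ji] := leP (rho i) (rho j).
    exists j; rewrite ?inE ?js ?orbT// => k; rewrite inE => /predU1P[->//|].
    exact: jmax.
  exists i; rewrite ?mem_head// => k; rewrite inE => /predU1P[->//|/jmax].
  by move=> /le_trans; apply; exact: ltW.
pose P i := `[< cube (b i) (rho i) `&` cube (b i0) (rho i0) = set0 >].
(* The selected cube contains its own corner, hence meets itself and is discarded too: the list gets
   shorter. *)
have nP0 : ~~ P i0.
  apply/asboolPn; rewrite setIid => /seteqP[+ _] => /(_ (b i0)); apply.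
  by apply/cubeE => i; rewrite lexx lerDl ltW.
have [|D [uD Ds Dd sD]] := IH [seq i <- s | P i].
  rewrite size_filter -ltnS (leq_trans _ sN)// ltnS -(count_predC P) -[ltnLHS]addn0.
  by rewrite ltn_add2l -has_count; apply/hasP; exists i0.
exists (i0 :: D); split.
- rewrite /= uD andbT; apply/negP => /Ds; rewrite mem_filter; case/andP => + _.
  exact/negP.
- by move=> i; rewrite inE => /predU1P[->//|/Ds]; rewrite mem_filter => /andP[].
- move=> i j; rewrite !inE => /predU1P[->|iD] /predU1P[->|jD] //.
  + by move=> _; rewrite setIC; move/Ds: jD; rewrite mem_filter => /andP[/asboolP].
  + by move=> _; move/Ds: iD; rewrite mem_filter => /andP[/asboolP].
  + exact: Dd.
- move=> i si; have [Pi|] := boolP (P i).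
    have [|j jD ij] := sD i; first by rewrite mem_filter Pi.
    by exists j => //; rewrite inE jD orbT.
  move=> /asboolPn/eqP/set0P H; exists i0; first exact: mem_head.
  by apply: cube_sub_triple H; exact: i0max.
Qed.

(** Subadditivity for the tripled cubes, exact additivity for the disjoint ones. *)
Lemma measure_triple_cubes_le (I : eqType) (b : I -> Rn R n) (rho : I -> R)
    (D : seq I) :
  (forall i, 0 < rho i) -> uniq D ->
  {in D &, forall i j, i <> j ->
    cube (b i) (rho i) `&` cube (b j) (rho j) = set0} ->
  (mu (\big[setU/set0]_(i <- D)
    cube (mkpt (fun k => xcoord (b i) k - rho i)%R) (3 * rho i)%R) <=
  (3 ^+ n)%:E * mu (\big[setU/set0]_(i <- D) cube (b i) (rho i)))%E.
Proof.
move=> rho0; elim: D => [|i D IH] /=; first by rewrite !big_nil !measure0 mule0.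
move=> /andP[iD uD] dD; rewrite !big_cons.
have mU (c : I -> Rn R n) (u : I -> R) :
    measurable (\big[setU/set0]_(j <- D) cube (c j) (u j)).
  by apply: bigsetU_measurable => j _; exact: measurable_cube.
rewrite [X in (_ <= _ * X)%E]measureU//; last 2 first.
  exact: measurable_cube.
  rewrite big_distrr/=; apply: big1_seq => j /= jD.
  by apply: dD; rewrite ?inE ?eqxx ?jD ?orbT// => ij; move: iD; rewrite ij jD.
apply: (le_trans (measureU2 _ _ _)) => //; first exact: measurable_cube.
rewrite ge0_muleDr//; apply: leeD.
  have := measure_cube (b i) (rho0 i) => bi.
  apply: (@le_trans _ _ ((3 ^+ n)%:E * (rho i ^+ n)%:E)%E); last by rewrite -bi.
  rewrite -EFinM -exprMn.
  by rewrite -(@measure_cube _ _ (mkpt (fun k => xcoord (b i) k - rho i))) ?mulr_gt0.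
by apply: IH => // j k jD kD; apply: dD; rewrite inE ?jD ?kD orbT.
Qed.

End vitali.

Section grid.
Context {R : realType} {n : nat}.
Local Notation mu := (@lebesgueRn R n).
Variable a : Rn R n.
Let Q0 := cube a 1.

(* (N, m) stands for the cube with corner a + m / N and side 2 / N; the N-th
   family makes every set of diameter 1 / N sit inside a cube of side 2 / N. *)
Definition grid_index := (nat * {ffun 'I_n -> nat})%type.
Definition grid_corner (i : grid_index) : Rn R n :=
  mkpt (fun k => xcoord a k + (i.2 k)%:R / i.1%:R).
Definition grid_side (i : grid_index) : R := 2 / i.1%:R.
Definition grid_cube i := cube (grid_corner i) (grid_side i).
Definition grid_valid (i : grid_index) :=
  (2 <= i.1)%N /\ forall k, (i.2 k + 2 <= i.1)%N.

(** The index type is countable, so no condition on [P] is required; this gives measurability of the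
    bad set. *)
Lemma measurable_bigcup_grid (P : set grid_index) :
  measurable (\bigcup_(i in P) grid_cube i).
Proof.
rewrite bigcup_mkcond; apply: countable_bigcupT_measurable => [|i].
  exact: (@countableP (nat * {ffun 'I_n -> nat})%type).
by case: ifP => // _; exact: measurable_cube.
Qed.

Lemma grid_side_gt0 i : grid_valid i -> 0 < grid_side i.
Proof. by move=> [i2 _]; rewrite divr_gt0// ltr0n; lia. Qed.

Lemma grid_cubeP i x : grid_valid i -> grid_cube i x <->
  forall k, (i.2 k)%:R <= i.1%:R * (xcoord x k - xcoord a k) <= (i.2 k)%:R + 2.
Proof.
move=> [i2 _].
have N0 : 0 < i.1%:R :> R by rewrite ltr0n; lia.
have H k : (xcoord (grid_corner i) k <= xcoord x k <=
      xcoord (grid_corner i) k + grid_side i) =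
    ((i.2 k)%:R <= i.1%:R * (xcoord x k - xcoord a k) <= (i.2 k)%:R + 2).
  rewrite xcoord_mkpt /grid_side -addrA -mulrDl; congr andb.
    by rewrite -(ler_pdivrMl _ _ N0) mulrC -lerBrDl.
  by rewrite -(ler_pdivlMl _ _ N0) mulrC -lerBlDl.
by split=> [/cubeE ix k|ix]; [rewrite -H|apply/cubeE => k; rewrite H].
Qed.

Lemma grid_cube_sub i : grid_valid i -> grid_cube i `<=` Q0.
Proof.
move=> vi x /(grid_cubeP _ vi) ix; apply/cubeE => k; have [i2 im] := vi.
have N0 : 0 < i.1%:R :> R by rewrite ltr0n; lia.
have := ix k; have : (i.2 k)%:R + 2 <= i.1%:R :> R by rewrite -natrD ler_nat.
have : 0 <= (i.2 k)%:R :> R by [].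
by nra.
Qed.

Lemma grid_cover x (e : R) : Q0 x -> 0 < e -> exists i, [/\ grid_valid i,
  grid_side i <= 8 * e & forall y, Q0 y -> supclose e x y -> grid_cube i y].
Proof.
move=> /cubeE Q0x e0; pose M := Num.truncn ((2 * e)^-1).
have e20 : 0 < 2 * e by lra.
have /andP[M1 M2] : M%:R <= (2 * e)^-1 < M.+1%:R.
  by apply: truncn_itv; rewrite invr_ge0 ltW.
have {}M1 : M%:R * (2 * e) <= 1 by rewrite -ler_pdivlMr// div1r.
have {}M2 : 1 < M.+1%:R * (2 * e) by rewrite -ltr_pdivrMr// div1r.
(* [N] is about [1 / (2 * e)], so the ball has diameter about one grid step. [v] rounds the lower
   end of the ball down, with value 0 below the face of [Q0]; the cap [N - 2] keeps the cube inside
   [Q0]. *)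
pose N := maxn 2 M.
pose v k := Num.truncn (N%:R * (xcoord x k - xcoord a k - e)).
pose m := [ffun k => minn (v k) (N - 2)] : {ffun 'I_n -> nat}.
have N2 : (2 <= N)%N by rewrite leq_maxl.
have N0 : 0 < N%:R :> R by rewrite ltr0n; lia.
have vi : grid_valid (N, m).
  by split => //= k; rewrite ffunE; have := geq_minr (v k) (N - 2); lia.
exists (N, m); split => //.
  rewrite /grid_side ler_pdivrMr//=.
  have : M.+1%:R <= 2 * N%:R :> R by rewrite -natrM ler_nat /N; lia.
  by nra.
move=> y /cubeE Q0y xy; apply/grid_cubeP => // k /=; rewrite ffunE.
have := xy k; rewrite ler_norml => xyk; have xk := Q0x k; have yk := Q0y k.
set u := v k.
have u2 : N%:R * (xcoord x k - xcoord a k - e) < u.+1%:R by exact: truncnS_gt.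
have u1 : u%:R <= N%:R * (xcoord y k - xcoord a k).
  have [pos|neg] := leP 0 (N%:R * (xcoord x k - xcoord a k - e)).
    by have := truncn_itv pos; rewrite -/u; nra.
  rewrite (_ : u = 0%N); first by nra.
  by apply/truncn0Pn; rewrite -ltNge (lt_trans neg).
apply/andP; split.
  by apply: le_trans u1; rewrite ler_nat geq_minl.
(* If the cap is reached, the cube extends to the upper face of [Q0]. Otherwise [N > 2], so [N = M]
   and the diameter [2 * e] is at most one step [1 / N]. *)
have [uN|Nu] := leqP (N - 2) u.
  by rewrite natrB// subrK; nra.
have NM : N = M by rewrite /N; lia.
by rewrite -natr1 in u2; rewrite -NM in M1; nra.
Qed.

End grid.

Section bad_set.
Local Open Scope ereal_scope.
Context {R : realType} {n : nat}.
Local Notation mu := (@lebesgueRn R n).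
Variable a : Rn R n.
Let Q0 := cube a 1.
Variables (f : Rn R n -> R) (lam t : R).
Hypothesis t01 : (0 < t < 1)%R.
Hypothesis Flam : F_sharp Q0 f t < lam%:E.

Definition bad i := grid_valid i /\ lam%:E < mean_osc f (grid_cube a i).

Definition bad_set := \bigcup_(i in bad) grid_cube a i.

Lemma measurable_bad_set : measurable bad_set.
Proof. exact: measurable_bigcup_grid. Qed.

Lemma bad_set_sub : bad_set `<=` Q0.
Proof. by move=> x [i [vi _]]; exact: grid_cube_sub. Qed.

(** The strict inequality [Flam] yields a level [tau < lam] that the sum over this packing exceeds
    on measure at most [t]; every bad cube lies in that level set. *)
Lemma measure_bad_packing (D : seq (@grid_index n)) : {in D, forall i, bad i} ->
  {in D &, forall i j, i <> j -> grid_cube a i `&` grid_cube a j = set0} ->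
  mu (\big[setU/set0]_(i <- D) grid_cube a i) <= t%:E.
Proof.
move=> Dbad Dd; pose p := [set grid_cube a i | i in [set` D]].
have pp : packing Q0 p.
  split.
  - by apply: finite_set_countable; apply: finite_image; exact: finite_seq.
  - move=> _ [i /= iD <-]; have [vi _] := Dbad _ iD; split; last exact: grid_cube_sub.
    by exists (grid_corner a i), (grid_side i); split => //; exact: grid_side_gt0.
  - move=> _ _ [i /= iD <-] [j /= jD <-] ij.
    have : grid_cube a i `&` grid_cube a j = set0.
      by apply: Dd => // ij'; apply: ij; rewrite ij'.
    rewrite -!subset0 => H x [xi xj]; apply: (H x); split.
      by case: xi => e e0; apply => k; rewrite subrr normr0.
    by case: xj => e e0; apply => k; rewrite subrr normr0.
have mp Q : p Q -> measurable Q by move=> [i _ <-]; exact: measurable_cube.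
have pc : countable p by case: pp.
have mS := measurable_S_sharp f pc mp.
have : rearrangement Q0 (S_sharp p f) t < lam%:E.
  apply: le_lt_trans Flam; apply: le_ereal_sup_tmp.
  by exists (rearrangement Q0 (S_sharp p f) t) => //; exists p.
rewrite /rearrangement; have -> : (t < 1)%R by case/andP: t01.
move=> /ereal_inf_ltP[_ [tau [tau0 dtau] <-]]; rewrite lte_fin => taulam.
apply: le_trans dtau; apply: le_measure; rewrite ?inE.
- by apply: bigsetU_measurable => j _; exact: measurable_cube.
- by apply: measurable_level_set => //; exact: measurable_cube.
move=> x; rewrite -bigcup_seq => -[i /= iD ix]; have [vi oi] := Dbad _ iD.
split; first exact: grid_cube_sub ix.
rewrite gee0_abs ?S_sharp_ge0//.
apply: (@lt_le_trans _ _ (mean_osc f (grid_cube a i))).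
  by apply: lt_trans oi; rewrite lte_fin.
by apply: S_sharp_ge => //; exists i.
Qed.

(** Vitali selection is finite, so it is applied to the bad indices of code below [m], followed by
    continuity of the measure from below. *)
Lemma measure_bad_set : mu bad_set <= (3 ^+ n * t)%:E.
Proof.
pose A m := [set i | bad i /\ (pickle i < m)%N].
pose U m := \bigcup_(i in A m) grid_cube a i.
have UE : bad_set = \bigcup_m U m.
  apply/seteqP; split => [x [i bi ix]|x [m _ [i [bi _] ix]]]; last by exists i.
  by exists (pickle i).+1 => //; exists i => //; split => //.
have mU m : measurable (U m).
  exact: measurable_bigcup_grid.
have ndU : nondecreasing_seq U.
  move=> k m km; apply/subsetPset => x [i [bi ik] ix]; exists i => //.
  by split => //; exact: leq_trans ik km.
have cU := @nondecreasing_cvg_mu _ _ _ mu _ mU (bigcupT_measurable U mU) ndU.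
rewrite UE -(cvg_lim _ cU)//; apply: lime_le.
  apply: ereal_nondecreasing_is_cvgn => k m km.
  by apply: le_measure; rewrite ?inE//; apply/subsetPset/ndU.
apply: nearW => m /=.
have /finite_seqP[s sE] : finite_set (A m).
  apply: (@sub_finite_set _ _ (pickle @^-1` `I_m)); first by move=> i [].
  by apply: finite_preimage => // i j _ _; exact: (pcan_inj pickleK).
have sb i : i \in s -> bad i.
  by move=> si; have [] : A m i by rewrite sE.
(* The selection wants positive sides for all indices; invalid ones, whose side may be [2 / 0 = 0],
   get the dummy side 1. *)
pose rho (i : @grid_index n) : R :=
  if `[< grid_valid i >] then grid_side i else 1%R.
have rho0 i : (0 < rho i)%R.
  by rewrite /rho; case: asboolP => // vi; exact: grid_side_gt0.
have rhoE i : i \in s -> rho i = grid_side i.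
  by move=> /sb[vi _]; rewrite /rho asboolT.
have [D [uD Ds Dd sD]] := @vitali_cubes _ _ _ (grid_corner a) rho s rho0.
have DE : \big[setU/set0]_(i <- D) grid_cube a i =
    \big[setU/set0]_(i <- D) cube (grid_corner a i) (rho i).
  by apply: eq_big_seq => i /Ds/rhoE ->.
apply: (@le_trans _ _ (mu (\big[setU/set0]_(i <- D)
    cube (mkpt (fun k => xcoord (grid_corner a i) k - rho i)%R) (3 * rho i)))).
  apply: le_measure; rewrite ?inE//.
    by apply: bigsetU_measurable => j _; exact: measurable_cube.
  move=> x [i]; rewrite sE /= => si; rewrite /grid_cube -rhoE// => ix.
  have [j jD ij] := sD _ si; rewrite -bigcup_seq; exists j => //; exact: ij.
apply: (le_trans (measure_triple_cubes_le rho0 uD Dd)).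
rewrite EFinM lee_wpmul2l// ?lee_fin ?exprn_ge0// -DE.
apply: measure_bad_packing => [i /Ds/sb//|i j iD jD ij].
by rewrite /grid_cube -!rhoE ?Ds//; exact: Dd.
Qed.

End bad_set.

(** * Dyadic cells *)

Section dyadic_cells.
Context {R : realType} {n : nat}.
Implicit Types (x y z : Rn R n) (u : R) (k j : nat).
Local Notation mu := (@lebesgueRn R n).
Variable a : Rn R n.
Let Q0 := cube a 1.

Definition side k : R := (2 ^+ k)^-1.

Lemma side_gt0 k : 0 < side k.
Proof. by rewrite invr_gt0 exprn_gt0. Qed.

Lemma sideS k : side k = 2 * side k.+1.
Proof. by rewrite /side exprS invfM mulrA mulfV// mul1r. Qed.

Lemma side_small (e : R) : 0 < e -> exists k, side k < e.
Proof.
move=> e0; exists (Num.truncn e^-1); rewrite /side.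
rewrite -[ltRHS]invrK ltf_pV2 ?posrE ?exprn_gt0 ?invr_gt0//.
apply: lt_le_trans (truncnS_gt _) _.
by rewrite -natrX ler_nat ltn_expl.
Qed.

(* At u = 1 the last cell of each generation is closed on the right, so that the
   cells partition the whole of [0, 1]. *)
Definition dyadic_index k u : nat :=
  if u < 1 then Num.truncn (2 ^+ k * u) else (2 ^ k).-1.

Lemma dyadic_indexP k u (m : nat) : 0 <= u <= 1 -> dyadic_index k u = m <->
  [/\ (m < 2 ^ k)%N, m%:R <= 2 ^+ k * u &
    2 ^+ k * u < m.+1%:R \/ m.+1 = (2 ^ k)%N].
Proof.
move=> /andP[u0 u1]; have p0 : 0 < 2 ^+ k :> R by rewrite exprn_gt0.
have pE : (2 ^ k)%:R = 2 ^+ k :> R by rewrite natrX.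
have pN : (0 < 2 ^ k)%N by rewrite expn_gt0.
have pu0 : 0 <= 2 ^+ k * u by rewrite mulr_ge0// ltW.
rewrite /dyadic_index; case: ifPn => [u1'|]; last first.
  rewrite -leNgt => u1'; have -> : u = 1 by lra.
  rewrite mulr1 -pE; split=> [<-|[mk _ [|]]].
  - by split; [lia|rewrite ler_nat; lia|right; lia].
  - by rewrite ltr_nat; lia.
  - by lia.
have pu1 : 2 ^+ k * u < (2 ^ k)%:R by rewrite pE; nra.
split=> [<-|[mk m1 m2]].
  have /andP[m1 m2] := truncn_itv pu0; split => //; last by left.
  by rewrite -(ltr_nat R) (le_lt_trans m1).
by apply: truncn_def; rewrite m1/=; case: m2 => // ->.
Qed.

Lemma dyadic_indexS k u : 0 <= u <= 1 ->
  dyadic_index k u = (dyadic_index k.+1 u)./2.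
Proof.
move=> u01; apply/dyadic_indexP => //.
have /(dyadic_indexP k.+1 _ u01) : dyadic_index k.+1 u = dyadic_index k.+1 u by [].
move: (dyadic_index k.+1 u) => m; rewrite expnS exprS => -[mk m1 m2].
have h1 : (m./2)%:R * 2 <= m%:R :> R by rewrite -natrM ler_nat; lia.
have h2 : m.+1%:R <= 2 * (m./2).+1%:R :> R by rewrite -natrM ler_nat; lia.
split; [lia|by lra|].
by case: m2 => [m2|m2]; [left; lra|right; lia].
Qed.

Definition same_cell k x y := forall i,
  dyadic_index k (xcoord x i - xcoord a i) =
  dyadic_index k (xcoord y i - xcoord a i).

Definition cell k x := [set y | Q0 y /\ same_cell k x y].

Lemma same_cell_sym k x y : same_cell k x y -> same_cell k y x.
Proof. by move=> xy i; rewrite xy. Qed.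

Lemma same_cell_trans k x y z : same_cell k x y -> same_cell k y z ->
  same_cell k x z.
Proof. by move=> xy yz i; rewrite xy. Qed.

Lemma cell_eq k x y : same_cell k x y -> cell k x = cell k y.
Proof.
move=> xy; apply/seteqP; split => z [Qz xz]; split => //.
  exact: same_cell_trans (same_cell_sym xy) xz.
exact: same_cell_trans xy xz.
Qed.

Lemma cell_refl k x : Q0 x -> cell k x x.
Proof. by []. Qed.

Lemma unit_cube_coord x i : Q0 x -> 0 <= xcoord x i - xcoord a i <= 1.
Proof. by move=> /cubeE/(_ i); lra. Qed.

Lemma same_cell_le j k x y : Q0 x -> Q0 y -> (j <= k)%N ->
  same_cell k x y -> same_cell j x y.
Proof.
move=> Qx Qy /subnK <-; elim: (k - j)%N => // l IH xy; apply: IH => i.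
by rewrite !(dyadic_indexS (l + j) (unit_cube_coord i _))// xy.
Qed.

Lemma same_cell0 x y : Q0 x -> Q0 y -> same_cell 0 x y.
Proof.
move=> Qx Qy i.
have H z : Q0 z -> dyadic_index 0 (xcoord z i - xcoord a i) = 0%N.
  move=> Qz; apply/dyadic_indexP; first exact: unit_cube_coord.
  by split; [|rewrite expr0 mul1r; have := unit_cube_coord i Qz; lra|right].
by rewrite !H.
Qed.

Lemma dyadic_index_bounds k x i : Q0 x ->
  let m : R := (dyadic_index k (xcoord x i - xcoord a i))%:R in
  m * side k <= xcoord x i - xcoord a i <= m * side k + side k.
Proof.
move=> Qx; set m := dyadic_index _ _ => /=.
have p0 : 0 < 2 ^+ k :> R by rewrite exprn_gt0.
have x01 := unit_cube_coord i Qx.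
have /(dyadic_indexP k _ x01)[_ m1 m2] :
  dyadic_index k (xcoord x i - xcoord a i) = m by [].
have {}m2 : 2 ^+ k * (xcoord x i - xcoord a i) <= m.+1%:R.
  case: m2 => [/ltW//|->]; rewrite natrX ler_piMr//.
  by case/andP: x01.
have -> : m%:R * side k + side k = m.+1%:R * side k by rewrite -natr1 mulrDl mul1r.
rewrite /side ler_pdivrMr// ler_pdivlMr//.
by rewrite mulrC m1.
Qed.

Lemma same_cell_close k x y : Q0 x -> Q0 y -> same_cell k x y ->
  supclose (side k) x y.
Proof.
move=> Qx Qy xy i; have := dyadic_index_bounds k i Qx.
have := dyadic_index_bounds k i Qy.
by rewrite /= (xy i) ler_norml; lra.
Qed.

Lemma measurable_cell k x : Q0 x -> measurable (cell k x).
Proof.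
move=> Qx; pose m i := dyadic_index k (xcoord x i - xcoord a i).
pose h i y : R := 2 ^+ k * (xcoord y i - xcoord a i).
have mh i : measurable_fun setT (h i).
  apply: measurable_funM => //; apply: measurable_funB => //.
  exact: measurable_xcoord.
pose A i := h i @^-1` [set` if (m i).+1 == (2 ^ k)%N
  then `[(m i)%:R, +oo[ else `[(m i)%:R, (m i).+1%:R[].
have -> : cell k x = Q0 `&` \bigcap_(i in [set: 'I_n]) A i.
  apply/seteqP; split => y [Qy xy]; split => // i.
    move=> _; have /esym/(dyadic_indexP k _ (unit_cube_coord i Qy))[_ m1 m2] := xy i.
    rewrite /A /=; case: ifPn => [_|/eqP mk]; rewrite in_itv/= ?andbT//.
    by rewrite m1/=; case: m2.
  apply/esym/dyadic_indexP; first exact: unit_cube_coord.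
  have /(dyadic_indexP k _ (unit_cube_coord i Qx))[mk _ _] :
    dyadic_index k (xcoord x i - xcoord a i) = m i by [].
  have := xy i I; rewrite /A /=; case: ifPn => [/eqP mk'|_].
    by rewrite in_itv/= andbT => m1; split => //; right.
  by rewrite in_itv/= => /andP[m1 m2]; split => //; left.
apply: measurableI; first exact: measurable_cube.
apply: fin_bigcap_measurable => // i _; rewrite -[X in measurable X]setTI.
by apply: mh => //; exact: measurable_itv.
Qed.

(** A closed cube of half the side at the lower corner avoids the excluded upper faces. The lost
    factor [2^n] reappears in the constants 64 and 1536. *)
Lemma measure_cell_ge k x : Q0 x -> (((side k / 2) ^+ n)%:E <= mu (cell k x))%E.
Proof.
move=> Qx; have s0 := side_gt0 k.
pose m i := dyadic_index k (xcoord x i - xcoord a i).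
pose b := mkpt (fun i => xcoord a i + (m i)%:R * side k).
rewrite -(@measure_cube _ _ b) ?divr_gt0//.
apply: le_measure; rewrite ?inE.
- exact: measurable_cube.
- exact: measurable_cell.
have p0 : 0 < 2 ^+ k :> R by rewrite exprn_gt0.
have ps : 2 ^+ k * side k = 1 by rewrite mulfV// gt_eqF.
move=> y /cubeE yb.
have mi i : (m i < 2 ^ k)%N /\ 2 ^+ k * (xcoord y i - xcoord a i) >= (m i)%:R /\
    2 ^+ k * (xcoord y i - xcoord a i) < (m i).+1%:R.
  have /(dyadic_indexP k _ (unit_cube_coord i Qx))[mk _ _] :
    dyadic_index k (xcoord x i - xcoord a i) = m i by [].
  split => //; have := yb i; rewrite xcoord_mkpt -[(m i).+1%:R]natr1 => /andP[y1 y2].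
  have {}y1 : 2 ^+ k * ((m i)%:R * side k) <= 2 ^+ k * (xcoord y i - xcoord a i).
    by rewrite ler_pM2l//; lra.
  have {}y2 : 2 ^+ k * (xcoord y i - xcoord a i) <=
      2 ^+ k * ((m i)%:R * side k + side k / 2).
    by rewrite ler_pM2l//; lra.
  move: y1 y2; rewrite (mulrDr _ (_ * side k))
    (mulrA _ (side k)) (mulrCA _ _ (side k)) ps => *.
  by split; lra.
have Qy : Q0 y.
  apply/cubeE => i; have [m1 [m2 m3]] := mi i.
  have : (m i).+1%:R <= 2 ^+ k :> R by rewrite -natrX ler_nat.
  by have : 0 <= (m i)%:R :> R by []; nra.
split => // i; apply/esym/dyadic_indexP; first exact: unit_cube_coord.
by have [m1 [m2 m3]] := mi i; split => //; left.
Qed.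

Lemma measure_cell k x : Q0 x -> (0 < mu (cell k x) < +oo)%E.
Proof.
move=> Qx; apply/andP; split.
  apply: lt_le_trans (measure_cell_ge k Qx).
  by rewrite lte_fin exprn_gt0// divr_gt0// side_gt0.
apply: (@le_lt_trans _ _ (mu Q0)); last by rewrite measure_cube// ltry.
apply: le_measure; rewrite ?inE; [exact: measurable_cell|exact: measurable_cube|].
by move=> y [].
Qed.

End dyadic_cells.

(** * Whitney decomposition *)

Lemma ler_natX (R : realType) (p q n : nat) : (p <= q)%N ->
  p%:R ^+ n <= q%:R ^+ n :> R.
Proof. by move=> pq; rewrite lerXn2r ?nnegrE ?ler0n ?ler_nat. Qed.

Section whitney.
Context {R : realType} {n : nat}.
Implicit Types (x y z : Rn R n) (j k : nat).
Local Notation mu := (@lebesgueRn R n).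
Variables (a : Rn R n) (E : set (Rn R n)).
Let Q0 := cube a 1.

(** The neighbourhood is taken relative to [Q0], so that cells along the faces of [Q0] can qualify.
    The cell is named by one of its points. *)
Definition inner_cell k x :=
  forall z, cell a k x z -> forall y, Q0 y -> supclose (side k) z y -> E y.

(* The maximal dyadic cells whose neighbourhood is inside E: a Whitney
   decomposition of (the interior of) E. *)
Definition stop k x :=
  [/\ Q0 x, inner_cell k x & forall j, (j < k)%N -> ~ inner_cell j x].

Lemma stop_uniq j k x : stop j x -> stop k x -> j = k.
Proof.
move=> [_ jx jm] [_ kx km]; have [jk|kj|//] := ltngtP j k.
- by have := km _ jk.
- by have := jm _ kj.
Qed.

Lemma stop_cell k x y : stop k x -> cell a k x y -> stop k y.
Proof.
move=> [Qx kx km] [Qy xy]; split => //.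
  by rewrite /inner_cell -(cell_eq xy).
move=> j jk jy; apply: (km _ jk); rewrite /inner_cell (cell_eq (y := y))//.
exact: same_cell_le (ltnW jk) xy.
Qed.

Lemma stop_far k x y : stop k x -> Q0 y -> ~ E y -> ~ supclose (side k) x y.
Proof. by move=> [Qx kx _] Qy Ey xy; apply: Ey; exact: (kx x (cell_refl k Qx)). Qed.

Lemma stop_inner k x : stop k x -> E x.
Proof.
move=> [Qx kx _]; apply: (kx x) => // i.
by rewrite subrr normr0 ltW// side_gt0.
Qed.

Lemma not_inner_near k x : Q0 x -> ~ inner_cell k x ->
  exists y, [/\ Q0 y, ~ E y & supclose (2 * side k) x y].
Proof.
move=> Qx nk; apply: contrapT => H; apply: nk => z [Qz xz] y Qy zy.
apply: contrapT => Ey; apply: H; exists y; split => //.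
have := supclose_trans (same_cell_close Qx Qz xz) zy.
by apply: supclose_le; lra.
Qed.

(** If some cell around [x] were inner, the first such generation would stop; hence none is, and [x]
    is a limit of points outside [E]. *)
Lemma nonstop_near k x : Q0 x -> (forall j, ~ stop j x) ->
  exists y, [/\ Q0 y, ~ E y & supclose (2 * side k) x y].
Proof.
move=> Qx nx; apply: not_inner_near => // kx.
have ex : exists j, `[< inner_cell j x >] by exists k; exact/asboolP.
case: (ex_minnP ex) => m /asboolP mx mmin; apply: (nx m); split => // j jm jx.
by have /mmin := asboolT jx; rewrite leqNgt jm.
Qed.

Hypothesis E_proper : exists2 y, Q0 y & ~ E y.

(** The parent cell is not inner, which gives twice its side. Generation 0 cannot stop, since its
    only cell is [Q0]. With [stop_far], the side is comparable to the distance to the complement of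
    [E]. *)
Lemma stop_near k x : stop k x ->
  exists y, [/\ Q0 y, ~ E y & supclose (4 * side k) x y].
Proof.
case: k => [|k] [Qx kx km].
  have [y Qy Ey] := E_proper; case: Ey; apply: (kx y) => //.
    by split => //; exact: same_cell0.
  by move=> i; rewrite subrr normr0 ltW// side_gt0.
have := not_inner_near Qx (km k (leqnn _)).
by rewrite (sideS k) mulrA (_ : 2 * 2 = 4 :> R)//; lra.
Qed.

(** Whitney cells labelled by a countable type: each piece is empty or a whole cell. *)
Definition piece (i : nat * {ffun 'I_n -> nat}) := [set x | stop i.1 x /\
  forall l, dyadic_index i.1 (xcoord x l - xcoord a l) = i.2 l].

Lemma piece_cell i x : piece i x -> piece i = cell a i.1 x.
Proof.
move=> [sx ix]; apply/seteqP; split => y.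
  by move=> [[Qy _ _] iy]; split => // l; rewrite ix iy.
by move=> xy; split; [exact: stop_cell xy|case: xy => _ xy l; rewrite -xy ix].
Qed.

Lemma stop_piece k x : stop k x -> exists2 i, piece i x & i.1 = k.
Proof.
move=> sx; exists (k, [ffun l => dyadic_index k (xcoord x l - xcoord a l)]) => //.
by split => // l; rewrite ffunE.
Qed.

Lemma piece_uniq i i' x : piece i x -> piece i' x -> i = i'.
Proof.
move: i i' => [k m] [k' m'] [/= sx ix] [/= sx' jx]; have kk := stop_uniq sx sx'.
by subst k'; congr pair; apply/ffunP => l; rewrite -ix jx.
Qed.

Variable f : Rn R n -> R.
Hypothesis fL : L1 Q0 f.

(** The good part of a Calderon-Zygmund decomposition along the stopping cells. The generation is
    unique by [stop_uniq], so [xget] returns the right one. *)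
Definition whitney_mean x : R :=
  if `[< exists k, stop k x >] then mean f (cell a (xget 0%N (stop^~ x)) x) else f x.

Local Notation f1 := whitney_mean.

Lemma whitney_mean_stop k x : stop k x -> f1 x = mean f (cell a k x).
Proof.
move=> sx; rewrite /whitney_mean asboolT; last by exists k.
have := xgetPex 0%N (ex_intro (stop^~ x) k sx) => /stop_uniq -/(_ _ sx) H.
by rewrite H.
Qed.

Lemma whitney_mean_nonstop x : (forall k, ~ stop k x) -> f1 x = f x.
Proof. by move=> nx; rewrite /whitney_mean asboolF// => -[k /nx]. Qed.

Lemma whitney_mean_cell k x y : stop k x -> cell a k x y ->
  f1 y = mean f (cell a k x).
Proof.
move=> sx xy; rewrite (whitney_mean_stop (stop_cell sx xy)).
by case: xy => _ xy; rewrite (cell_eq xy).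
Qed.

Let mQ0 : measurable Q0.
Proof. exact: measurable_cube. Qed.

Let mf_sub A : A `<=` Q0 -> measurable_fun A f.
Proof. exact: measurable_fun_L1 fL. Qed.

(** Whole cells rather than their traces on [S], because a mean is controlled only on its full cell;
    empty sets pad the enumeration. *)
Definition pieces (S : set (Rn R n)) l :=
  if pickle_inv l is Some i then
    if `[< piece i `&` S !=set0 >] then piece i else set0
  else set0.

Lemma piecesP S l : pieces S l = set0 \/
  exists k x, [/\ S x, stop k x & pieces S l = cell a k x].
Proof.
rewrite /pieces; case: pickle_inv => [i|]; last by left.
case: asboolP => [[x [ix Sx]]|_]; last by left.
by right; exists i.1, x; split => //; [case: ix|exact: piece_cell].
Qed.

Lemma measurable_pieces S l : measurable (pieces S l).
Proof.
have [->//|[k [x [_ [Qx _ _] ->]]]] := piecesP S l.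
exact: measurable_cell.
Qed.

Lemma trivIset_pieces S : trivIset setT (pieces S).
Proof.
move=> l m _ _ [x []]; rewrite /pieces.
case ul : (pickle_inv l) => [i|//]; case: asboolP => // _ ix.
case um : (pickle_inv m) => [j|//]; case: asboolP => // _ jx.
have K := @pickle_invK (nat * {ffun 'I_n -> nat})%type.
have := K l; have := K m; rewrite ul um /= => <- <-.
by rewrite (piece_uniq ix jx).
Qed.

Lemma pieces_stop S k x : S x -> stop k x -> exists l, pieces S l x.
Proof.
move=> Sx /stop_piece[i ix _]; exists (pickle i); rewrite /pieces pickleK_inv.
by rewrite asboolT//; exists x.
Qed.

Lemma bigcup_pieces_sub S B :
  (forall k x, S x -> stop k x -> cell a k x `<=` B) -> \bigcup_l pieces S l `<=` B.
Proof.
move=> SB x [l _]; have [->//|[k [y [Sy sy ->]]]] := piecesP S l.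
exact: SB.
Qed.

Lemma cell_sub k x : cell a k x `<=` Q0.
Proof. by move=> y []. Qed.

Lemma measurable_whitney_mean A : measurable A -> A `<=` Q0 ->
  measurable_fun A f1.
Proof.
move=> mA AQ; apply: (measurable_funS mQ0 AQ).
have mU : measurable (\bigcup_l pieces Q0 l).
  by apply: bigcupT_measurable => l; exact: measurable_pieces.
have UQ : \bigcup_l pieces Q0 l `<=` Q0.
  by apply: bigcup_pieces_sub => k x _ _; exact: cell_sub.
rewrite -(setDUK UQ); apply/measurable_funU => //; first exact: measurableD.
split.
  apply/measurable_fun_bigcup => l; first exact: measurable_pieces.
  have [->|[k [x [_ sx ->]]]] := piecesP Q0 l; first exact: measurable_fun_set0.
  apply: (eq_measurable_fun (cst (mean f (cell a k x)))).
    by move=> y; rewrite inE => xy; rewrite (whitney_mean_cell sx xy).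
  exact: measurable_cst.
apply: (eq_measurable_fun f); last by apply: mf_sub => x [].
move=> x; rewrite inE => -[Qx nx]; rewrite whitney_mean_nonstop// => k sx; apply: nx.
by have [l lx] := pieces_stop Qx sx; exists l.
Qed.

Lemma measurable_whitney_diff A : measurable A -> A `<=` Q0 ->
  measurable_fun A (fun x => `|f x - f1 x|%:E).
Proof.
move=> mA AQ; apply/measurable_EFinP; apply: measurableT_comp => //.
apply: measurable_funB; first exact: mf_sub.
exact: measurable_whitney_mean.
Qed.

Local Open Scope ereal_scope.

Lemma integral_whitney_cell k x (c : R) : stop k x ->
  \int[mu]_(y in cell a k x) `|f y - f1 y|%:E <=
  2%:E * \int[mu]_(y in cell a k x) `|f y - c|%:E.
Proof.
move=> sx; have [Qx _ _] := sx; have mC := measurable_cell k Qx.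
rewrite (eq_integral (fun y => `|f y - mean f (cell a k x)|%:E)); last first.
  by move=> y; rewrite inE => xy; rewrite (whitney_mean_cell sx xy).
apply: integral_sub_mean_le => //; first exact: measure_cell.
apply: integrableS fL => //; exact: cell_sub.
Qed.

(** [f - f1] vanishes off the Whitney cells, so estimates on the cells meeting [S] add up. Used with
    [S = Q0], [B = E] for the L1 bound, and with a cube [S] and a ball [B] for the BMO bound. *)
Lemma integral_whitney_diff (S B : set (Rn R n)) (g : Rn R n -> \bar R) :
  measurable S -> S `<=` Q0 -> measurable B -> B `<=` Q0 ->
  measurable_fun B g -> (forall x, 0 <= g x) ->
  (forall k x, S x -> stop k x -> cell a k x `<=` B) ->
  (forall k x, S x -> stop k x -> \int[mu]_(y in cell a k x) `|f y - f1 y|%:E <=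
    \int[mu]_(y in cell a k x) g y) ->
  \int[mu]_(x in S) `|f x - f1 x|%:E <= \int[mu]_(x in B) g x.
Proof.
move=> mS SQ mB BQ mg g0 SB Sg.
have mP l : measurable (pieces S l) by exact: measurable_pieces.
have mU : measurable (\bigcup_l pieces S l) by exact: bigcupT_measurable.
have UB : \bigcup_l pieces S l `<=` B by exact: bigcup_pieces_sub.
have UQ := subset_trans UB BQ.
have -> : \int[mu]_(x in S) `|f x - f1 x|%:E =
    \int[mu]_(x in S `&` \bigcup_l pieces S l) `|f x - f1 x|%:E.
  rewrite integral_mkcond [RHS]integral_mkcond; apply: eq_integral => x _.
  rewrite !patchE in_setI; have [xS|//] := boolP (x \in S); rewrite /=.
  case: ifPn => // /negP nU; rewrite whitney_mean_nonstop ?subrr ?normr0// => k sx.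
  by apply: nU; rewrite inE; have [l lx] := pieces_stop (set_mem xS) sx; exists l.
apply: (@le_trans _ _ (\int[mu]_(x in \bigcup_l pieces S l) `|f x - f1 x|%:E)).
  apply: ge0_subset_integral => //; first exact: measurableI.
  exact: measurable_whitney_diff.
apply: (@le_trans _ _ (\int[mu]_(x in \bigcup_l pieces S l) g x)); last first.
  exact: ge0_subset_integral.
apply: le_integral_bigcup => //.
- exact: trivIset_pieces.
- exact: measurable_whitney_diff.
- exact: measurable_funS mg.
move=> l; have [->|[k [x [Sx sx ->]]]] := piecesP S l.
  by rewrite !integral_set0.
exact: Sg.
Qed.

Definition qball x (e : R) := [set y | Q0 y /\ supclose e x y].

Lemma measurable_qball x e : measurable (qball x e).
Proof.
rewrite (_ : qball x e = Q0 `&` cube (mkpt (fun i => xcoord x i - e)%R) (2 * e)).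
  by apply: measurableI => //; exact: measurable_cube.
apply/seteqP; split => y [Qy xy]; split => //.
  by apply/cubeE => i; have := xy i; rewrite xcoord_mkpt ler_norml; lra.
move=> i; move: xy => /cubeE/(_ i); rewrite xcoord_mkpt ler_norml; lra.
Qed.

Lemma qball_sub x e : qball x e `<=` Q0.
Proof. by move=> y []. Qed.

Variable lam : R.
Hypothesis lam0 : (0 <= lam)%R.
(** For the bad set: such a ball lies in a grid cube of side at most [8 * e] that contains [y],
    hence has oscillation at most [lam]. *)
Hypothesis good : forall x e y, Q0 x -> (0 < e)%R -> Q0 y -> ~ E y ->
  supclose e x y ->
  exists c, \int[mu]_(z in qball x e) `|f z - c|%:E <= (lam * (8 * e) ^+ n)%:E.

(** A Whitney cell lies in a ball of radius [4 * side k] touching the complement of [E], and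
    [8 * 4 * side k] is 64 times [side k / 2]; the factor 2 pays for the mean. *)
Lemma integral_whitney_L1 : measurable E -> E `<=` Q0 ->
  \int[mu]_(x in Q0) `|f x - f1 x|%:E <= (2 * 64 ^+ n * lam)%:E * mu E.
Proof.
move=> mE EQ; rewrite -integral_cst//; apply: integral_whitney_diff => //.
- by move=> x; rewrite lee_fin !mulr_ge0// exprn_ge0.
- move=> k x Qx sx y xy; exact: stop_inner (stop_cell sx xy).
move=> k x Qx sx; have s0 := @side_gt0 R k.
have [y [Qy Ey xy]] := stop_near sx.
have [|c Hc] := good Qx _ Qy Ey xy; first by rewrite mulr_gt0.
apply: (le_trans (integral_whitney_cell c sx)).
rewrite integral_cst//; last exact: measurable_cell.
apply: (@le_trans _ _ (2%:E * (lam * (8 * (4 * side k)) ^+ n)%:E)).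
  rewrite lee_pmul2l//; apply: le_trans Hc.
  apply: ge0_subset_integral => //.
  - exact: measurable_cell.
  - exact: measurable_qball.
  - by apply: measurable_absB; apply: mf_sub; exact: qball_sub.
  move=> z [Qz xz]; split => //; apply: supclose_le (same_cell_close Qx Qz xz).
  by lra.
apply: (@le_trans _ _ ((2 * 64 ^+ n * lam)%:E * ((side k / 2) ^+ n)%:E)); last first.
  rewrite lee_wpmul2l ?measure_cell_ge// lee_fin !mulr_ge0// exprn_ge0//.
rewrite -!EFinM lee_fin (_ : 8 * _ = 64 * (side k / 2))%R; last by lra.
by rewrite exprMn; lra.
Qed.

(* The Whitney cells meeting a cube that is close to the complement of E are at
   most twice as large, hence all lie in one ball where f oscillates little. *)
Lemma whitney_osc_near b (r : R) x y : (0 < r)%R -> cube b r `<=` Q0 ->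
  cube b r x -> Q0 y -> ~ E y -> supclose r x y ->
  exists c, \int[mu]_(z in cube b r) `|f1 z - c|%:E <=
    (3 * lam * (24 * r) ^+ n)%:E.
Proof.
move=> r0 QQ Qx Qy Ey xy.
have mQ : measurable (cube b r) by exact: measurable_cube.
have mB := measurable_qball x (3 * r).
have BQ := @qball_sub x (3 * r).
(* Points of the cube are within [2 * r] of [y], so their Whitney cells have side below [2 * r] and
   stay within [r + 2 * r] of [x]. *)
have [| |c Hc] := good (e := (3 * r)%R) (QQ _ Qx) _ Qy Ey.
- by lra.
- by apply: supclose_le xy; lra.
exists c.
have mfB : measurable_fun (qball x (3 * r)) (fun z => `|f z - c|%:E).
  by apply: measurable_absB; exact: mf_sub.
have mfQ : measurable_fun (cube b r) (fun z => `|f z - c|%:E).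
  by apply: measurable_absB; exact: mf_sub.
have QB : cube b r `<=` qball x (3 * r).
  move=> z Qz; split; first exact: QQ.
  by apply: supclose_le (supclose_cube Qx Qz); lra.
have H1 : \int[mu]_(z in cube b r) `|f z - c|%:E <=
    \int[mu]_(z in qball x (3 * r)) `|f z - c|%:E.
  exact: ge0_subset_integral.
have H2 : \int[mu]_(z in cube b r) `|f z - f1 z|%:E <=
    2%:E * \int[mu]_(z in qball x (3 * r)) `|f z - c|%:E.
  rewrite -ge0_integralZl_EFin//; apply: integral_whitney_diff => //.
  - exact: measurable_funeM.
  - move=> k z Qz sz w [Qw zw]; split => //.
    have xz := supclose_cube Qx Qz.
    have zy : supclose (r + r) z y := supclose_trans (supclose_sym xz) xy.
    have sr : (side k < 2 * r)%R.
      rewrite ltNge; apply/negP => sk; apply: (stop_far sz Qy Ey).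
      by apply: supclose_le zy; lra.
    have := supclose_trans xz (same_cell_close (QQ _ Qz) Qw zw).
    by apply: supclose_le; lra.
  - move=> k z Qz sz; have Qz' := QQ _ Qz.
    rewrite ge0_integralZl_EFin//; last 2 first.
      exact: measurable_cell.
      by apply: measurable_absB; apply: mf_sub; exact: cell_sub.
    exact: integral_whitney_cell.
have H3 : \int[mu]_(z in cube b r) `|f1 z - c|%:E <=
    \int[mu]_(z in cube b r) `|f z - c|%:E + \int[mu]_(z in cube b r) `|f z - f1 z|%:E.
  have mf1 := measurable_whitney_mean mQ QQ.
  have md := measurable_whitney_diff mQ QQ.
  rewrite -ge0_integralD//; apply: ge0_le_integral => //.
  - exact: measurable_absB.
  - exact: emeasurable_funD.
  move=> z _; rewrite -EFinD lee_fin [leRHS]addrC.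
  by rewrite (le_trans (ler_distD (f z) _ _))// (distrC (f1 z)).
apply: (le_trans H3); apply: (le_trans (leeD H1 H2)).
rewrite -[X in X + _]mul1e -ge0_muleDl//.
rewrite -mulrA EFinM (_ : 1 + 2%:E = 3%:E) ?lee_pmul2l//.
  by rewrite (_ : 24 * r = 8 * (3 * r))%R//; lra.
Qed.

(* All the Whitney cells meeting a cube that is far from the complement of E
   have a side larger than D / 32, where D is 4 times the side of one of them,
   and lie in a ball of radius 3 D: 1536 = (8 * 3) * (2 * 32). *)
Lemma whitney_osc_far b (r : R) : (0 < r)%R -> cube b r `<=` Q0 ->
  (forall x y, cube b r x -> Q0 y -> ~ E y -> ~ supclose r x y) ->
  exists c, forall x, cube b r x -> (`|f1 x - c| <= 1536 ^+ n * lam)%R.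
Proof.
move=> r0 QQ far.
(* A point in no stopping cell has points outside [E] arbitrarily close, contrary to [far]. *)
have stopped x : cube b r x -> exists k, stop k x.
  move=> Qx; apply: contrapT => nx.
  have [k sk] := @side_small R _ (divr_gt0 r0 (ltr0n R 2)).
  have [|y [Qy Ey xy]] := @nonstop_near k x (QQ _ Qx).
    by move=> j sj; apply: nx; exists j.
  by apply: (far x y) => //; apply: supclose_le xy; lra.
have Qb : cube b r b by apply/cubeE => i; rewrite lexx lerDl ltW.
have [k0 sb] := stopped _ Qb; have [y0 [Qy0 Ey0 by0]] := stop_near sb.
pose D : R := (4 * side k0)%R.
have s00 := @side_gt0 R k0.
have rD : (r < D)%R.
  rewrite ltNge; apply/negP => Dr; apply: (far b y0) => //.
  exact: supclose_le by0.
have [| |c Hc] := good (e := (3 * D)%R) (QQ _ Qb) _ Qy0 Ey0.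
- by rewrite /D; lra.
- by apply: supclose_le by0; rewrite /D; lra.
exists c => x Qx; have [k sx] := stopped _ Qx; have Q0x := QQ _ Qx.
have sk0 := @side_gt0 R k.
have xb := supclose_cube Qx Qb.
(* [y0] is within [r + D < 2 * D] of [x], too close for a larger cell; so the cell of [x] stays
   within [3 * D] of [b]. *)
have sk1 : (side k < 2 * D)%R.
  rewrite ltNge; apply/negP => Dk; apply: (stop_far sx Qy0 Ey0).
  by apply: supclose_le (supclose_trans xb by0); rewrite /D in Dk rD; lra.
have sk2 : (D < 32 * side k)%R.
  have [y [Qy Ey xy]] := stop_near sx.
  have r4 : (r < 4 * side k)%R.
    rewrite ltNge; apply/negP => kr; apply: (far x y) => //.
    exact: supclose_le xy.
  (* [y] is within [r + 4 * side k < 8 * side k] of [b], which bounds [side k0 = D / 4]. *)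
  rewrite ltNge; apply/negP => kD; apply: (stop_far sb Qy Ey).
  apply: supclose_le (supclose_trans (supclose_sym xb) xy).
  by rewrite /D in kD; lra.
rewrite (whitney_mean_stop sx).
have mC := measurable_cell k Q0x.
have CB : cell a k x `<=` qball b (3 * D).
  move=> z [Qz xz]; split => //.
  apply: supclose_le (supclose_trans (supclose_sym xb) (same_cell_close Q0x Qz xz)).
  by lra.
have fC : mu.-integrable (cell a k x) (EFin \o f).
  by apply: integrableS fL => //; exact: cell_sub.
have H : `|mean f (cell a k x) - c|%:E * mu (cell a k x) <=
    (lam * (8 * (3 * D)) ^+ n)%:E.
  apply: (le_trans (mean_sub_le c mC (measure_cell k Q0x) fC)).
  apply: le_trans Hc; apply: ge0_subset_integral => //.
  - exact: measurable_qball.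
  - by apply: measurable_absB; apply: mf_sub; exact: qball_sub.
have D0 : (0 < D)%R by rewrite mulr_gt0.
have Dn0 : (0 < (D / 64) ^+ n)%R by rewrite exprn_gt0// divr_gt0.
(* [D / 64 < side k / 2], so this factor is below the measure of the cell. *)
rewrite -lee_fin -(@lee_pmul2r _ ((D / 64) ^+ n)%:E)//.
apply: (@le_trans _ _ (`|mean f (cell a k x) - c|%:E * mu (cell a k x))).
  rewrite lee_wpmul2l//; apply: le_trans (measure_cell_ge k Q0x).
  rewrite lee_fin; apply: lerXn2r; rewrite ?nnegrE ?divr_ge0 ?ltW//.
  by lra.
apply: (le_trans H); rewrite -EFinM lee_fin.
rewrite (_ : 8 * _ = 1536 * (D / 64))%R; last by lra.
by rewrite exprMn mulrCA mulrA.
Qed.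

(** The dichotomy compares the distance to the complement of [E] with the side [r]. The near case
    gives [2 * 3 * 24^n], the far case [2 * 1536^n]. *)
Lemma BMO_norm_whitney : L1 Q0 f1 -> BMO_norm Q0 f1 <= (6 * 1536 ^+ n * lam)%:E.
Proof.
have K24 := @ler_natX R 24 1536 n isT.
have K0 : (0 <= 1536 ^+ n :> R)%R := exprn_ge0 n (ler0n R 1536).
move: (1536 ^+ n)%R K0 K24 whitney_osc_far => K K0 K24 osc_far.
move=> f1L; apply/ereal_supP => _ [_ [[b [r [r0 ->]]] QQ] <-].
have mQ : measurable (cube b r) by exact: measurable_cube.
have muQ : mu (cube b r) = (r ^+ n)%:E by exact: measure_cube.
have muQ0 : 0 < mu (cube b r) < +oo by rewrite muQ lte_fin exprn_gt0//= ltry.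
have f1Q : mu.-integrable (cube b r) (EFin \o f1) by apply: integrableS f1L.
have rn0 : (0 < r ^+ n)%R by rewrite exprn_gt0.
have [[x [y [Qx Qy Ey xy]]]|far] := pselect (exists x y,
    [/\ cube b r x, Q0 y, ~ E y & supclose r x y]).
  have [c Hc] := whitney_osc_near r0 QQ Qx Qy Ey xy.
  apply: (@mean_osc_le _ _ _ _ c) => //; rewrite muQ.
  apply: (@le_trans _ _ (2%:E * (3 * lam * (24 * r) ^+ n)%:E)).
    by rewrite lee_pmul2l.
  rewrite -!EFinM lee_fin exprMn.
  by move: K24 => /(ler_wpM2r (mulr_ge0 lam0 (ltW rn0))); lra.
have [c Hc] : exists c, forall x, cube b r x -> (`|f1 x - c| <= K * lam)%R.
  apply: osc_far => // x y Qx Qy Ey xy.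
  by apply: far; exists x, y.
have M0 : (0 <= K * lam)%R by exact: mulr_ge0.
apply: (@mean_osc_le _ _ _ _ c) => //.
apply: (@le_trans _ _ (2%:E * \int[mu]_(x in cube b r) cst (K * lam)%:E x)).
  rewrite lee_pmul2l//; apply: ge0_le_integral => //.
  - by apply: measurable_absB; exact: measurable_whitney_mean.
rewrite integral_cst// muleA -EFinM lee_wpmul2r// lee_fin; lra.
Qed.

End whitney.

(** * The upper bound *)

Section upper_bound.
Local Open Scope ereal_scope.
Context {R : realType} {n : nat}.
Local Notation mu := (@lebesgueRn R n).
Variable a : Rn R n.
Let Q0 := cube a 1.

Let mQ0 : measurable Q0.
Proof. exact: measurable_cube. Qed.

Let muQ0 : mu Q0 = 1.
Proof. by rewrite measure_cube// expr1n. Qed.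

Lemma good_ball_osc (f : Rn R n -> R) (lam : R) x (e : R) y :
  L1 Q0 f -> (0 <= lam)%R ->
  Q0 x -> (0 < e)%R -> Q0 y -> ~ bad_set a f lam y -> supclose e x y ->
  exists c, \int[mu]_(z in qball a x e) `|f z - c|%:E <= (lam * (8 * e) ^+ n)%:E.
Proof.
move=> fL lam0 Qx e0 Qy Ey xy; have [i [vi ie iB]] := grid_cover Qx e0.
have mG : measurable (grid_cube a i) by exact: measurable_cube.
have GQ : grid_cube a i `<=` Q0 := grid_cube_sub vi.
have s0 := @grid_side_gt0 R _ _ vi.
have muG : mu (grid_cube a i) = (grid_side i ^+ n)%:E by exact: measure_cube.
have oi : mean_osc f (grid_cube a i) <= lam%:E.
  rewrite leNgt; apply/negP => oi; apply: Ey; exists i; first by split.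
  exact: iB.
exists (mean f (grid_cube a i)).
apply: (@le_trans _ _ (\int[mu]_(z in grid_cube a i)
    `|f z - mean f (grid_cube a i)|%:E)).
  apply: ge0_subset_integral => //; first exact: measurable_qball.
    by apply: measurable_absB; exact: measurable_fun_L1 fL GQ.
  by move=> z [Qz xz]; exact: iB.
rewrite mean_oscE ?muG ?lte_fin ?exprn_gt0//= ?ltry//.
apply: (@le_trans _ _ (lam%:E * (grid_side i ^+ n)%:E)).
  by rewrite lee_wpmul2r// lee_fin exprn_ge0// ltW.
rewrite -EFinM lee_fin ler_wpM2l// lerXn2r// ?nnegrE ?ltW//.
by rewrite mulr_gt0.
Qed.

Lemma K_le_level (f : Rn R n -> R) (t lam : R) : L1 Q0 f -> (0 < t)%R ->
  (3 ^+ n * t < 1)%R -> F_sharp Q0 f t < lam%:E ->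
  K_L1_BMO Q0 t f <= (8 * 1536 ^+ n * t * lam)%:E.
Proof.
move=> fL t0 t1 Flam.
have lam0 : (0 <= lam)%R.
  by rewrite -lee_fin (le_trans _ (ltW Flam))//; exact: F_sharp_ge0.
have t01 : (0 < t < 1)%R.
  have h3 : (1 <= 3 ^+ n :> R)%R by apply: exprn_ege1; lra.
  by rewrite t0 (le_lt_trans _ t1)// ler_peMl// ltW.
pose E := bad_set a f lam.
have mE : measurable E by exact: measurable_bad_set.
have EQ : E `<=` Q0 by exact: bad_set_sub.
have muE : mu E <= (3 ^+ n * t)%:E by exact: measure_bad_set.
(* Otherwise [1 = mu Q0 <= mu E <= 3^n t < 1]. *)
have Ep : exists2 y, Q0 y & ~ E y.
  apply: contrapT => H; have QE : Q0 `<=` E.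
    by move=> y Qy; apply: contrapT => Ey; apply: H; exists y.
  have : 1 <= mu E by rewrite -muQ0; apply: le_measure; rewrite ?inE.
  by move=> /le_trans/(_ muE); rewrite lee_fin leNgt t1.
have good x e y := @good_ball_osc f lam x e y fL lam0.
pose f1 := whitney_mean a E f; pose f0 := (f \- f1)%R.
have mf1 : measurable_fun Q0 f1 by exact: measurable_whitney_mean.
have mf : measurable_fun Q0 f := measurable_fun_L1 fL (@subset_refl _ Q0).
have If0 : \int[mu]_(x in Q0) `|f0 x|%:E <= (2 * 192 ^+ n * lam * t)%:E.
  apply: (le_trans (integral_whitney_L1 Ep fL lam0 good mE EQ)).
  apply: (@le_trans _ _ ((2 * 64 ^+ n * lam)%:E * (3 ^+ n * t)%:E)).
    by rewrite lee_wpmul2l// lee_fin !mulr_ge0// exprn_ge0.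
  rewrite -EFinM lee_fin (_ : 192 = 64 * 3 :> R)%R; last by lra.
  by rewrite exprMn; move: (64 ^+ n)%R (3 ^+ n)%R => K K'; lra.
have f0L : L1 Q0 f0.
  apply/integrableP; split; last exact: le_lt_trans If0 (ltry _).
  by apply/measurable_EFinP; exact: measurable_funB.
have f1L : L1 Q0 f1.
  have := integrableB mQ0 fL f0L; apply: eq_integrable => // x _ /=.
  by rewrite -EFinD /f0 /= subKr.
have Bf1 := BMO_norm_whitney Ep fL lam0 good f1L.
apply: ge_ereal_inf.
exists (L1_norm_mod_cst Q0 f0 + t%:E * BMO_norm Q0 f1).
  exists (f0, f1) => //; split => //.
    by split => //; exact: le_lt_trans Bf1 (ltry _).
  by exists 0%R; apply: aeW => x _; rewrite addr0 /= /f0 /= [RHS]subrK.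
apply: (@le_trans _ _ ((2 * 192 ^+ n * lam * t)%:E +
    t%:E * (6 * 1536 ^+ n * lam)%:E)).
  apply: leeD; last by rewrite lee_pmul2l.
  apply: ge_ereal_inf; exists (\int[mu]_(x in Q0) `|f0 x - 0|%:E).
    by exists 0%R.
  by under eq_integral do rewrite subr0.
(* [192 = 64 * 3] joins the L1 constant to the bound on [mu E]; then
   [2 * 192^n + 6 * 1536^n <= 8 * 1536^n]. *)
rewrite -EFinM -EFinD lee_fin.
have := @ler_natX R 192 1536 n isT.
move: (192 ^+ n)%R (1536 ^+ n)%R => K K' /(ler_wpM2r (mulr_ge0 lam0 (ltW t0))).
by lra.
Qed.

Lemma K_le_F_sharp (f : Rn R n -> R) (t : R) : L1 Q0 f -> (0 < t <= 1)%R ->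
  K_L1_BMO Q0 t f <= (8 * 1536 ^+ n * t)%:E * F_sharp Q0 f t.
Proof.
move=> fL /andP[t0 t1]; 
have K0 : (0 < 1536 ^+ n :> R)%R := exprn_gt0 n (ltr0Sn R _).
have K3 := @ler_natX R 3 1536 n isT.
have level lam := @K_le_level f t lam fL t0.
move: (1536 ^+ n)%R K0 K3 level => K K0 K3 level; set C := (8 * K * t)%R.
have C0 : (0 < C)%R by rewrite !mulr_gt0.
have F0 : 0 <= F_sharp Q0 f t by exact: F_sharp_ge0.
have [t3|t3] := leP 1%R (3 ^+ n * t)%R.
  apply: (le_trans (K_le_mean_osc _ _ fL t0)) => //.
  apply: (le_trans (mean_osc_le_F_sharp _ _ f t1)) => //.
  rewrite -[leLHS]mul1e lee_wpmul2r// lee_fin (le_trans t3)// ler_wpM2r ?ltW//.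
  by lra.
case F : (F_sharp Q0 f t) => [v| |]; last by rewrite F in F0.
  (* Levels must lie strictly above [F_sharp], so [lam = v + e / C] is used, with excess exactly [e]
     after multiplication by [C]. *)
  apply/lee_addgt0Pr => e e0; rewrite -EFinM -EFinD.
  have -> : (C * v + e = C * (v + e / C))%R.
    by rewrite mulrDr (mulrCA C e) mulfV ?mulr1// gt_eqF.
  by apply: level => //; rewrite F lte_fin ltrDl divr_gt0.
by rewrite gt0_muley ?lte_fin// leey.
Qed.

End upper_bound.

Theorem theorem7 (R : realType) (n : nat) (n_gt0 : (0 < n)%N) :
  exists c1 c2 : R, [/\ 0 < c1, 0 < c2 &
    forall Q0 : set (Rn R n), is_cube Q0 -> lebesgueRn n Q0 = 1%E ->
    forall f : Rn R n -> R, L1 Q0 f ->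
    forall t : R, 0 < t <= 1 ->
      ((c1 * t)%:E * F_sharp Q0 f t <= K_L1_BMO Q0 t f)%E /\
      (K_L1_BMO Q0 t f <= (c2 * t)%:E * F_sharp Q0 f t)%E].
Proof.
exists 4^-1, (8 * 1536 ^+ n); split.
- by rewrite invr_gt0.
- exact: mulr_gt0 (ltr0Sn R _) (exprn_gt0 n (ltr0Sn R _)).
move=> _ [a [r [r0 ->]]]; rewrite measure_cube// => -[/eqP].
(* As [0 < n], measure [r^n = 1] forces [r = 1], the side for which grids and dyadic cells are set
   up. *)
rewrite pexpr_eq1// ?ltW// => /eqP -> f fL t t01.
by split; [exact: F_sharp_le_K|exact: K_le_F_sharp].
Qed.
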